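(* Suppose $C$ has full row rank, $X\succ0$, $(A,B)$ is controllable, and $(C,A)$ and $(Q^{1/2},A)$ are observable. If an observable stationary point $\mathsf K^\star\in\mathbb{K}_o\cap\mathbb{K}_s\cap\mathbb{K}$ of the problem $\min_{\mathsf K\in\mathbb{K}}J(\mathsf K)$ exists, then it is unique and is of the form $$\mathsf K^\star=\mathscr{T}_{T^\star}(\mathsf K^\ddagger),\qquad \mathsf K^\ddagger:=\begin{bmatrix}0&-K^\star\\ L^\star&A-BK^\star-L^\star C\end{bmatrix},$$ where: - $T^\star$ is the optimal transformation matrix associated with $\mathsf K^\ddagger$ (i.e. $J(\mathscr{T}_{T^\star}(\mathsf K^\ddagger))\le J(\mathscr{T}_{T}(\mathsf K^\ddagger))$ for all $T\in\mathrm{GL}_n$), and it is given by $T^\star=X_{22}X_{12}^{-1}$; - $L^\star=A\hat\Sigma C^{\mathsf T}(C\hat\Sigma C^{\mathsf T})^{-1}$, where $\hat\Sigma$ is the unique positive definite solution of $$\hat\Sigma=\Delta_X+A\hat\Sigma A^{\mathsf T}-A\hat\Sigma C^{\mathsf T}(C\hat\Sigma C^{\mathsf T})^{-1}C\hat\Sigma A^{\mathsf T},\qquad \Delta_X:=X_{11}-X_{12}X_{22}^{-1}X_{12}^{\mathsf T};$$ - $K^\star=(R+B^{\mathsf T}\hat PB)^{-1}B^{\mathsf T}\hat PA$, where $\hat P$ is the unique positive definite solution of $$\hat P=Q+A^{\mathsf T}\hat PA-A^{\mathsf T}\hat PB(R+B^{\mathsf T}\hat PB)^{-1}B^{\mathsf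 T}\hat PA.$$
   Context: Fix $A\in\mathbb{R}^{n\times n}$, $B\in\mathbb{R}^{n\times m}$, $C\in\mathbb{R}^{d\times n}$, $Q\in\mathbb{R}^{n\times n}$ symmetric positive semidefinite and $R\in\mathbb{R}^{m\times m}$ symmetric positive definite. The system is $x_{t+1}=Ax_t+Bu_t$, $y_t=Cx_t$, controlled by the full-order dynamic controller $\xi_{t+1}=A_{\mathsf K}\xi_t+B_{\mathsf K}y_t$, $u_t=C_{\mathsf K}\xi_t$, with $A_{\mathsf K}\in\mathbb{R}^{n\times n}$, $B_{\mathsf K}\in\mathbb{R}^{n\times d}$, $C_{\mathsf K}\in\mathbb{R}^{m\times n}$. Controller parameters are collected as $\mathsf K=\begin{bmatrix}0_{m\times d}&C_{\mathsf K}\\ B_{\mathsf K}&A_{\mathsf K}\end{bmatrix}$. Put $$\bar A=\begin{bmatrix}A&0\\ 0&0\end{bmatrix},\ \bar B=\begin{bmatrix}B&0\\ 0&I_n\end{bmatrix},\ \bar C=\begin{bmatrix}C&0\\ 0&I_n\end{bmatrix},\ \bar Q=\begin{bmatrix}Q&0\\ 0&0_{n\times n}\end{bmatrix},\ \bar R=\begin{bmatrix}R&0\\ 0&0_{n\times n}\end{bmatrix},$$ so that $\bar A+\bar B\mathsf K\bar C=\begin{bmatrix}A&BC_{\mathsf K}\\ B_{\mathsf K}C&A_{\mathsf K}\end{bmatrix}$ is the closed-loop matrix for $\bar x_t=(x_t,\xi_t)$. $\mathbb{K}$ is the set of $\mathsf K$ of the block form $\begin{bmatrix}0_{m\times d}&C_{\mathsf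 K}\\ B_{\mathsf K}&A_{\mathsf K}\end{bmatrix}$ with spectral radius $\rho(\bar A+\bar B\mathsf K\bar C)<1$; $\mathbb{K}_o$ is the set of $\mathsf K$ of this block form with $(C_{\mathsf K},A_{\mathsf K})$ observable. The initial state $\bar x_0=(x_0,\xi_0)$ follows a fixed distribution $\bar{\mathcal D}$ independent of $\mathsf K$, with finite second moments, and $X=\mathbb{E}_{\bar x_0\sim\bar{\mathcal D}}[\bar x_0\bar x_0^{\mathsf T}]=\begin{bmatrix}X_{11}&X_{12}\\ X_{12}^{\mathsf T}&X_{22}\end{bmatrix}$ with $n\times n$ blocks. The dLQR cost on $\mathbb{K}$ is $J(\mathsf K)=\mathbb{E}_{\bar x_0\sim\bar{\mathcal D}}\left[\sum_{t=0}^\infty (x_t^{\mathsf T}Qx_t+u_t^{\mathsf T}Ru_t)\right]=\mathrm{Tr}(P_{\mathsf K}X)$, where $P_{\mathsf K}$ is the unique positive semidefinite solution of $P_{\mathsf K}=\bar Q+\bar C^{\mathsf T}\mathsf K^{\mathsf T}\bar R\mathsf K\bar C+(\bar A+\bar B\mathsf K\bar C)^{\mathsf T}P_{\mathsf K}(\bar A+\bar B\mathsf K\bar C)$. $\mathbb{K}_s$ is the set of stationary points: controllers at which the gradients of $J$ with respect to the free blocks $A_{\mathsf K},B_{\mathsf K},C_{\mathsf K}$ all vanish. $\mathrm{GL}_n$ is the set of invertible real $n\times n$ matrices, and for $T\in\mathrm{GL}_n$, $\mathscr{T}_T(\mathsf K)=\begin{bmatrix}0&C_{\mathsf K}T^{-1}\\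 TB_{\mathsf K}&TA_{\mathsf K}T^{-1}\end{bmatrix}$. The formula for $T^\star$ includes the assertion that $X_{12}$ is invertible when an observable stationary point exists. *)

(* Defs.v *)
From HB Require Import structures.
From mathcomp Require Import all_boot all_order all_algebra.
From mathcomp Require Import complex.
From mathcomp Require Import all_classical all_reals all_analysis.

Set Implicit Arguments.
Unset Strict Implicit.
Unset Printing Implicit Defensive.

Import Order.TTheory GRing.Theory Num.Theory.
Import numFieldNormedType.Exports.

Local Open Scope classical_set_scope.
Local Open Scope ring_scope.

Section MatrixNotions.
Context {R : realType}.

Definition qform (n : nat) (M : 'M[R]_n) (v : 'cV[R]_n) : R :=
  (v^T *m M *m v) ord0 ord0.

Definition possemidef (n : nat) (M : 'M[R]_n) : Prop :=
  M^T = M /\ forall v : 'cV[R]_n, 0 <= qform M v.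

Definition posdef (n : nat) (M : 'M[R]_n) : Prop :=
  M^T = M /\ forall v : 'cV[R]_n, v != 0 -> 0 < qform M v.

(* [Q^(1/2)], which exists and is unique for [Q] positive semidefinite; the
   default value 0 is irrelevant in that case. *)
Definition sqrtmx (n : nat) (Q : 'M[R]_n) : 'M[R]_n :=
  xget 0 [set S : 'M[R]_n | possemidef S /\ S *m S = Q].

(* The modulus is taken over the complex eigenvalues; [sup set0 = 0] covers
   the empty matrix. *)
Definition spectral_radius (n : nat) (M : 'M[R]_n) : R :=
  sup [set ComplexField.Normc.normc z
      | z in [set z : R[i] | eigenvalue (map_mx (real_complex R) M) z]].

(* [rank [B, AB, ..., A^(n-1) B] = n] *)
Definition controllable (n m : nat) (A : 'M[R]_n) (B : 'M[R]_(n, m)) : Prop :=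
  \rank (\mxrow_(i < n) (A ^+ i *m B)) = n.

(* [rank [C; CA; ...; C A^(n-1)] = n] *)
Definition observable (n d : nat) (C : 'M[R]_(d, n)) (A : 'M[R]_n) : Prop :=
  \rank (\mxcol_(i < n) (C *m A ^+ i)) = n.

Definition gradient (p q : nat) (f : 'M[R]_(p, q) -> R) (M : 'M[R]_(p, q)) :
    'M[R]_(p, q) :=
  \matrix_(i < p, j < q) 'D_(delta_mx i j) f M.

(* Differentiability is required so that the partial derivatives are not the
   default value of a non-existing limit. *)
Definition gradient_vanishes (p q : nat) (f : 'M[R]_(p, q) -> R)
    (M : 'M[R]_(p, q)) : Prop :=
  differentiable f M /\ gradient f M = 0.

End MatrixNotions.

Section Controllers.
Context {R : realType} {n m d : nat}.

Definition controller (CK : 'M[R]_(m, n)) (BK : 'M[R]_(n, d)) (AK : 'M[R]_n) :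
    'M[R]_(m + n, d + n) :=
  block_mx 0 CK BK AK.

Definition ctrlA (K : 'M[R]_(m + n, d + n)) : 'M[R]_n := drsubmx K.
Definition ctrlB (K : 'M[R]_(m + n, d + n)) : 'M[R]_(n, d) := dlsubmx K.
Definition ctrlC (K : 'M[R]_(m + n, d + n)) : 'M[R]_(m, n) := ursubmx K.

Definition controller_form : set 'M[R]_(m + n, d + n) :=
  [set K | K = controller (ctrlC K) (ctrlB K) (ctrlA K)].

Definition similarity (T : 'M[R]_n) (K : 'M[R]_(m + n, d + n)) :
    'M[R]_(m + n, d + n) :=
  controller (ctrlC K *m invmx T) (T *m ctrlB K) (T *m ctrlA K *m invmx T).

Definition observable_controllers : set 'M[R]_(m + n, d + n) :=
  [set K | controller_form K /\ observable (ctrlC K) (ctrlA K)].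

Definition Abar (A : 'M[R]_n) : 'M[R]_(n + n) := block_mx A 0 0 0.
Definition Bbar (B : 'M[R]_(n, m)) : 'M[R]_(n + n, m + n) :=
  block_mx B 0 0 1%:M.
Definition Cbar (C : 'M[R]_(d, n)) : 'M[R]_(d + n, n + n) :=
  block_mx C 0 0 1%:M.

Definition stabilizing_controllers (A : 'M[R]_n) (B : 'M[R]_(n, m))
    (C : 'M[R]_(d, n)) : set 'M[R]_(m + n, d + n) :=
  [set K | controller_form K /\
           spectral_radius (Abar A + Bbar B *m K *m Cbar C) < 1].

(* The pair [(x_t, xi_t)]. *)
Fixpoint trajectory (A : 'M[R]_n) (B : 'M[R]_(n, m)) (C : 'M[R]_(d, n))
    (K : 'M[R]_(m + n, d + n)) (x0 xi0 : 'cV[R]_n) (t : nat) :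
    'cV[R]_n * 'cV[R]_n :=
  if t is s.+1 then
    let: (x, xi) := trajectory A B C K x0 xi0 s in
    let u := ctrlC K *m xi in
    let y := C *m x in
    (A *m x + B *m u, ctrlA K *m xi + ctrlB K *m y)
  else (x0, xi0).

Definition stage_cost (A : 'M[R]_n) (B : 'M[R]_(n, m)) (C : 'M[R]_(d, n))
    (Q : 'M[R]_n) (Rw : 'M[R]_m) (K : 'M[R]_(m + n, d + n))
    (x0 xi0 : 'cV[R]_n) (t : nat) : R :=
  let: (x, xi) := trajectory A B C K x0 xi0 t in
  qform Q x + qform Rw (ctrlC K *m xi).

End Controllers.

Section Cost.
Context {R : realType} {n m d : nat}.
Context (A : 'M[R]_n) (B : 'M[R]_(n, m)) (C : 'M[R]_(d, n)).
Context (Q : 'M[R]_n) (Rw : 'M[R]_m).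
Context {disp : measure_display} {Omega : measurableType disp}.
Context (P : probability Omega R) (xbar0 : Omega -> 'cV[R]_(n + n)).

(* The initial distribution is the law of the random vector [xbar0]. *)
Definition finite_second_moments : Prop :=
  forall i : 'I_(n + n), (fun w => xbar0 w i ord0) \in Lfun P 2%:E.

Definition second_moment : 'M[R]_(n + n) :=
  \matrix_(i < n + n, j < n + n)
    fine 'E_P[(fun w => xbar0 w i ord0 * xbar0 w j ord0)%R]%E.

(* The expected total cost. It is extended-real valued because the series may
   diverge when [K] is not stabilizing; it is finite when [K] is. *)
Definition dlqr_cost (K : 'M[R]_(m + n, d + n)) : \bar R :=
  (\int[P]_w \sum_(0 <= t <oo)
     (stage_cost A B C Q Rw K (usubmx (xbar0 w)) (dsubmx (xbar0 w)) t)%:E)%E.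

Definition stationary_points : set 'M[R]_(m + n, d + n) :=
  let J CK BK AK := fine (dlqr_cost (controller CK BK AK)) in
  [set K | [/\ controller_form K,
    gradient_vanishes (fun AK => J (ctrlC K) (ctrlB K) AK) (ctrlA K),
    gradient_vanishes (fun BK => J (ctrlC K) BK (ctrlA K)) (ctrlB K) &
    gradient_vanishes (fun CK => J CK (ctrlB K) (ctrlA K)) (ctrlC K)]].

Definition optimal_transformation (K : 'M[R]_(m + n, d + n)) (T : 'M[R]_n) :
    Prop :=
  T \in unitmx /\ forall T' : 'M[R]_n, T' \in unitmx ->
    (dlqr_cost (similarity T K) <= dlqr_cost (similarity T' K))%E.

End Cost.

Section Riccati.
Context {R : realType} {n m d : nat}.

Definition filter_riccati (A : 'M[R]_n) (C : 'M[R]_(d, n)) (Delta S : 'M[R]_n) :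
    Prop :=
  S = Delta + A *m S *m A^T
      - A *m S *m C^T *m invmx (C *m S *m C^T) *m C *m S *m A^T.

Definition filter_gain (A : 'M[R]_n) (C : 'M[R]_(d, n)) (S : 'M[R]_n) :
    'M[R]_(n, d) :=
  A *m S *m C^T *m invmx (C *m S *m C^T).

Definition control_riccati (A : 'M[R]_n) (B : 'M[R]_(n, m)) (Q : 'M[R]_n)
    (Rw : 'M[R]_m) (S : 'M[R]_n) : Prop :=
  S = Q + A^T *m S *m A
      - A^T *m S *m B *m invmx (Rw + B^T *m S *m B) *m B^T *m S *m A.

Definition control_gain (A : 'M[R]_n) (B : 'M[R]_(n, m)) (Rw : 'M[R]_m)
    (S : 'M[R]_n) : 'M[R]_(m, n) :=
  invmx (Rw + B^T *m S *m B) *m B^T *m S *m A.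

End Riccati.

(* Main.v *)
Require Import Defs.
From HB Require Import structures.
From mathcomp Require Import all_boot all_order all_algebra.
From mathcomp Require Import complex.
From mathcomp Require Import all_classical all_reals all_analysis.
From mathcomp Require Import ring lra.
Import Order.TTheory GRing.Theory Num.Theory.
Import numFieldNormedType.Exports.
Local Open Scope classical_set_scope.
Local Open Scope ring_scope.
Set Implicit Arguments.
Unset Strict Implicit.
Unset Printing Implicit Defensive.

(** For a stabilizing controller with closed-loop matrix F the cost equals
tr (P X), where P = W + F^T P F is the value matrix and X the second moment of
the initial state; dually, it equals tr (W S), where S = X + F S F^T
accumulates the second moments of the trajectory (stein_duality).  Both
equations are solvable because the powers of F tend to zero, which makes
P |-> P - F^T P F injective (stein_exists).  A Lyapunov function of F serves
all closed loops near F, so these solutions stay bounded there and the cost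
has an expansion with quadratic remainder (cost_expansion).  Its linear term
turns stationarity into three equations on the blocks of P F S
(stationary_equations).

The rest is algebra.  Put H = - P22^-1 P12^T and G = S12 S22^-1, and let
Ph and Sh be the Schur complements of P22 in P and of S22 in S.  Eliminating
blocks, the stationarity equations become AK = H (A - B K - L C) G, BK = H L
and CK = - K G, with K and L the gains associated with Ph and Sh.  Substituted
into the equation of P, these formulas make P12 = - Z G and P22 = G^T Z G for
a symmetric Z.  Observability of the controller makes P22 positive definite,
so G is invertible; then H = G^-1, and the block P11 leaves exactly the
control Riccati equation for Ph.  The equation of S, with G = H^-1, leaves
H X12 = X22 and the filter Riccati equation for Sh (stationary_structure).
Hence X12 is invertible, H = X22 X12^-1, and the controller is the
H-transform of the one built from Ph and Sh.

The two Riccati equations have at most one positive definite solution, since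
each such solution makes its own closed loop stable and the difference D of
two solutions satisfies D = F^T D F' for the two closed loops
(riccati_unique); this is the uniqueness of the stationary point.  Finally,
along the orbit of similarity transformations the cost is
tr (P X) + tr (P22 (V - 1) X22 (V - 1)^T) with V = H T^-1 (cost_gap), which is
minimal exactly at T = H. *)

(** * Quadratic forms and definite matrices *)

(** Closes identities between matrices that hold in the additive group once
every matrix product is treated as an atom; products are captured up to the
unification of their structure instances. *)
Ltac mx_abel :=
  repeat match goal with
  | |- context [@mulmx ?S ?k ?l ?q ?a ?b] =>
      let x := fresh "x" in set x := (@mulmx S k l q a b); clearbody x
  end;
  apply/matrixP => ? ?; rewrite !mxE; ring.

Section Quadratic.
Context {R : realType}.

Lemma trmxD p q (M N : 'M[R]_(p, q)) : (M + N)^T = M^T + N^T.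
Proof. exact: linearD. Qed.
Lemma trmxB p q (M N : 'M[R]_(p, q)) : (M - N)^T = M^T - N^T.
Proof. exact: linearB. Qed.
Lemma trmxN p q (M : 'M[R]_(p, q)) : (- M)^T = - M^T.
Proof. exact: linearN. Qed.
Lemma trmxZ p q a (M : 'M[R]_(p, q)) : (a *: M)^T = a *: M^T.
Proof. exact: linearZ. Qed.

Lemma qform_tr n (M : 'M[R]_n) v : qform M v = \tr (M *m (v *m v^T)).
Proof. by rewrite /qform mulmxA mxtrace_mulC mulmxA trace_mx11. Qed.

Lemma qformD n (M N : 'M[R]_n) v : qform (M + N) v = qform M v + qform N v.
Proof. by rewrite !qform_tr mulmxDl linearD. Qed.

Lemma qformN n (M : 'M[R]_n) v : qform (- M) v = - qform M v.
Proof. by rewrite !qform_tr mulNmx linearN. Qed.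

Lemma qformZ n a (M : 'M[R]_n) v : qform (a *: M) v = a * qform M v.
Proof. by rewrite !qform_tr -scalemxAl linearZ. Qed.

Lemma qform0 n (M : 'M[R]_n) : qform M 0 = 0.
Proof. by rewrite /qform mulmx0 mxE. Qed.

Lemma qform_conj n p (M : 'M[R]_p) (F : 'M[R]_(p, n)) v :
  qform (F^T *m M *m F) v = qform M (F *m v).
Proof. by rewrite /qform trmx_mul !mulmxA. Qed.

Lemma qform_gram n p (Y : 'M[R]_(p, n)) v :
  qform (Y^T *m Y) v = \sum_i (Y *m v) i ord0 ^+ 2.
Proof.
rewrite -[Y^T]mulmx1 qform_conj /qform mulmx1 mxE.
by apply: eq_bigr => i _; rewrite mxE expr2.
Qed.

Lemma qform_gram_ge0 n p (Y : 'M[R]_(p, n)) v : 0 <= qform (Y^T *m Y) v.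
Proof. by rewrite qform_gram sumr_ge0 // => i _; rewrite sqr_ge0. Qed.

Lemma qform_gram_eq0 n p (Y : 'M[R]_(p, n)) v :
  qform (Y^T *m Y) v = 0 -> Y *m v = 0.
Proof.
rewrite qform_gram => /eqP.
rewrite psumr_eq0 => [/allP Y0|i _]; last by rewrite sqr_ge0.
apply/matrixP => i j; rewrite (ord1 j) [RHS]mxE; apply/eqP.
by have := Y0 i (mem_index_enum i); rewrite /= sqrf_eq0.
Qed.

Lemma qform1E n (v : 'cV[R]_n) : qform 1%:M v = \sum_i v i ord0 ^+ 2.
Proof. by rewrite -[1%:M]mulmx1 -{1}[1%:M]trmx1 qform_gram mul1mx. Qed.

Lemma qform1_ge0 n (v : 'cV[R]_n) : 0 <= qform 1%:M v.
Proof. by rewrite qform1E sumr_ge0 // => i _; rewrite sqr_ge0. Qed.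

Lemma gram_psd n p (Y : 'M[R]_(p, n)) : possemidef (Y^T *m Y).
Proof. by split=> [|v]; rewrite ?trmx_mul ?trmxK //; apply: qform_gram_ge0. Qed.

Lemma posdef_psd n (M : 'M[R]_n) : posdef M -> possemidef M.
Proof.
move=> [Ms M0]; split=> // v.
by have [->|/M0/ltW //] := eqVneq v 0; rewrite qform0.
Qed.

Lemma psd_posdef n (M : 'M[R]_n) :
  possemidef M -> (forall v, qform M v = 0 -> v = 0) -> posdef M.
Proof.
move=> [Ms M0] Minj; split=> // v v0; rewrite lt_neqAle M0 andbT eq_sym.
by apply: contra_neq v0 => /Minj.
Qed.

Lemma posdef_eq0 n (M : 'M[R]_n) v : posdef M -> qform M v = 0 -> v = 0.
Proof.
move=> [_ M0] Mv; apply/eqP; apply: contraT => /M0.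
by rewrite Mv ltxx.
Qed.

Lemma posdef1 n : posdef (1%:M : 'M[R]_n).
Proof.
apply: psd_posdef.
  by rewrite -[1%:M]mulmx1 -{1}[1%:M]trmx1; apply: gram_psd.
move=> v; rewrite -[1%:M]mulmx1 -{1}[1%:M]trmx1 => /qform_gram_eq0.
by rewrite mul1mx.
Qed.

Lemma posdefD n (M N : 'M[R]_n) : posdef M -> possemidef N -> posdef (M + N).
Proof.
move=> [Ms M0] [Ns N0]; split; first by rewrite linearD /= Ms Ns.
by move=> v /M0 Mv; rewrite qformD ltr_pwDl.
Qed.

Lemma psd_conj n p (M : 'M[R]_p) (F : 'M[R]_(p, n)) :
  possemidef M -> possemidef (F^T *m M *m F).
Proof.
move=> [Ms M0]; split; first by rewrite !trmx_mul trmxK Ms mulmxA.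
by move=> v; rewrite qform_conj.
Qed.

Lemma posdef_conj n p (M : 'M[R]_p) (F : 'M[R]_(p, n)) :
  posdef M -> (forall v : 'cV_n, F *m v = 0 -> v = 0) ->
  posdef (F^T *m M *m F).
Proof.
move=> Mpd Finj; apply: psd_posdef; first exact/psd_conj/posdef_psd.
by move=> v; rewrite qform_conj => /(posdef_eq0 Mpd)/Finj.
Qed.

Lemma unitmx_ker0 n (M : 'M[R]_n) :
  (forall v : 'cV_n, M *m v = 0 -> v = 0) -> M \in unitmx.
Proof.
move=> Minj; rewrite -unitmx_tr -row_free_unit; apply: inj_row_free => u uM.
apply: trmx_inj; rewrite trmx0; apply: Minj.
by rewrite -[M]trmxK -trmx_mul uM trmx0.
Qed.

Lemma posdef_unit n (M : 'M[R]_n) : posdef M -> M \in unitmx.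
Proof.
move=> Mpd; apply: unitmx_ker0 => v Mv; apply: (posdef_eq0 Mpd).
by rewrite /qform -mulmxA Mv mulmx0 mxE.
Qed.

Lemma invmx_sym n (M : 'M[R]_n) : M^T = M -> (invmx M)^T = invmx M.
Proof. by move=> Ms; rewrite trmx_inv Ms. Qed.

(** Completing the square in the second block of variables. *)
Lemma block_schur n p (X11 : 'M[R]_n) (X12 : 'M[R]_(n, p)) (X22 : 'M[R]_p) :
  X22 \in unitmx -> X22^T = X22 ->
  block_mx X11 X12 X12^T X22 =
    (row_mx 1%:M 0)^T *m (X11 - X12 *m invmx X22 *m X12^T) *m row_mx 1%:M 0
    + (row_mx (invmx X22 *m X12^T) 1%:M)^T *m X22
      *m row_mx (invmx X22 *m X12^T) 1%:M.
Proof.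
move=> Xu Xs; rewrite !tr_row_mx !trmx1 trmx0 !mul_col_mx !mul_mx_row.
rewrite -!block_mxEv trmx_mul trmxK (invmx_sym Xs) !mul1mx !mul0mx !mulmx1 !mulmx0.
rewrite !mulmxA !(mulmxKV Xu) (mulmxV Xu) mul1mx.
by rewrite add_block_mx !add0r subrK.
Qed.

Lemma schur_psd n p (X11 : 'M[R]_n) (X12 : 'M[R]_(n, p)) (X22 : 'M[R]_p) :
  possemidef (block_mx X11 X12 X12^T X22) -> posdef X22 ->
  possemidef (X11 - X12 *m invmx X22 *m X12^T).
Proof.
move=> [Xs X0] pd2; have Xu := posdef_unit pd2; have [s2 _] := pd2.
have X11s : X11^T = X11.
  by move: Xs; rewrite tr_block_mx => /eq_block_mx[].
split; first by rewrite linearB /= !trmx_mul trmxK X11s (invmx_sym s2) mulmxA.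
move=> v; have := X0 (col_mx v (- (invmx X22 *m X12^T *m v))).
rewrite block_schur //; move: (X11 - _) => S.
rewrite qformD !qform_conj !mul_row_col mul0mx addr0 !mul1mx.
by rewrite subrr qform0 addr0.
Qed.

Lemma posdef_drsub n p (X11 : 'M[R]_n) (X12 : 'M[R]_(n, p)) (X22 : 'M[R]_p) :
  posdef (block_mx X11 X12 X12^T X22) -> posdef X22.
Proof.
move=> Xpd; have := @posdef_conj _ _ _ (col_mx 0 1%:M : 'M[R]_(n + p, p)) Xpd.
rewrite tr_col_mx trmx0 trmx1 mul_row_block mul_row_col !mul0mx !mulmx0.
rewrite !mul1mx mulmx1 !add0r; apply => v; rewrite mul_col_mx mul0mx mul1mx.
by rewrite -[0 in RHS]col_mx0 => /eq_col_mx[].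
Qed.

Lemma schur_posdef n p (X11 : 'M[R]_n) (X12 : 'M[R]_(n, p)) (X22 : 'M[R]_p) :
  posdef (block_mx X11 X12 X12^T X22) ->
  posdef (X11 - X12 *m invmx X22 *m X12^T).
Proof.
move=> Xpd; have pd2 := posdef_drsub Xpd.
have Xu := posdef_unit pd2; have [s2 _] := pd2.
apply: psd_posdef; first exact: schur_psd (posdef_psd Xpd) pd2.
move=> v Xv; have : qform (block_mx X11 X12 X12^T X22)
    (col_mx v (- (invmx X22 *m X12^T *m v))) = 0.
  rewrite block_schur //; move: (X11 - _) Xv => S Xv.
  rewrite qformD !qform_conj !mul_row_col mul0mx addr0 !mul1mx.
  by rewrite subrr qform0 addr0 Xv.
by move/(posdef_eq0 Xpd); rewrite -[0 in RHS]col_mx0 => /eq_col_mx[].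
Qed.

(** Eliminating the last n variables leaves the 1 x 1 Schur complement, which
is positive, so that a square root of it and a factor of the lower right block
give a factor of the whole matrix. *)
Lemma cholesky n (X : 'M[R]_n) :
  posdef X -> exists2 V : 'M[R]_n, V \in unitmx & X = V^T *m V.
Proof.
move=> Xpd; suff [V eqX] : exists V : 'M[R]_n, X = V^T *m V.
  exists V => //; have := posdef_unit Xpd.
  by rewrite eqX unitmx_mul unitmx_tr andbb.
elim: n X Xpd => [|n IH] X Xpd.
  by exists 0; apply/matrixP => -[].
rewrite -[n.+1]/(1 + n)%N in X Xpd *.
have Xs := Xpd.1; move: Xpd Xs.
rewrite -[X]submxK; move: (ulsubmx _) (ursubmx _) (dlsubmx _) (drsubmx _).
move=> a b c N Xpd Xs.
have [sa sb sN] : [/\ a^T = a, c = b^T & N^T = N].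
  by move: Xs; rewrite tr_block_mx => /eq_block_mx[].
rewrite {c}sb in Xpd Xs *.
have Npd := posdef_drsub Xpd.
have [V eqN] := IH _ Npd.
have Spd := schur_posdef Xpd.
have S0 : 0 < (a - b *m invmx N *m b^T) 0 0.
  have := Spd.2 1%:M; rewrite /qform trmx1 mul1mx mulmx1; apply.
  by apply/negP => /eqP/matrixP/(_ 0 0); rewrite !mxE => /eqP; rewrite oner_eq0.
exists (col_mx (Num.sqrt ((a - b *m invmx N *m b^T) 0 0) *: row_mx 1%:M 0)
   (V *m row_mx (invmx N *m b^T) 1%:M)).
rewrite block_schur ?posdef_unit // tr_col_mx mul_row_col; congr (_ + _).
  rewrite [(_ *: row_mx _ _)^T]linearZ /= -scalemxAl -scalemxAr scalerA -expr2.
  rewrite sqr_sqrtr ?ltW //.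
  rewrite [X in _ *m X *m _]mx11_scalar mul_mx_scalar -scalemxAl //.
by rewrite trmx_mul eqN !mulmxA.
Qed.

(** A crude modulus of continuity of quadratic forms, from 2 |v_i v_j| <= v_i ^
2 + v_j ^ 2; the value of the constant never matters. *)
Lemma qform_bound n (S : 'M[R]_n) :
  exists2 c, 0 <= c & forall v, `|qform S v| <= c * qform 1%:M v.
Proof.
exists (\sum_i \sum_j `|S i j|).
  by apply: sumr_ge0 => i _; apply: sumr_ge0 => j _.
move=> v; have -> : qform S v = \sum_i \sum_j S i j * v i 0 * v j 0.
  rewrite /qform -mulmxA mxE; apply: eq_bigr => i _.
  by rewrite mxE mxE mulr_sumr; apply: eq_bigr => j _; ring.
apply: (le_trans (ler_norm_sum _ _ _)); rewrite mulr_suml ler_sum // => i _.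
apply: (le_trans (ler_norm_sum _ _ _)); rewrite mulr_suml ler_sum // => j _.
rewrite !normrM -mulrA ler_wpM2l //.
have le k : `|v k 0| ^+ 2 <= qform 1%:M v.
  rewrite qform1E (bigD1 k) //= real_normK ?num_real // lerDl.
  by apply: sumr_ge0 => l _; rewrite sqr_ge0.
have := le i; have := le j; have := sqr_ge0 (`|v i 0| - `|v j 0|).
nra.
Qed.

(** With V a factor of a definite matrix, this reduces every trace inequality
below to the quadratic form of S on the rows of V. *)
Lemma trace_gram n p (S : 'M[R]_n) (V : 'M[R]_(p, n)) :
  \tr (S *m (V^T *m V)) = \sum_i qform S (row i V)^T.
Proof.
rewrite mulmxA mxtrace_mulC /mxtrace; apply: eq_bigr => i _.
rewrite /qform trmxK tr_row -!mulmxA mxE [RHS]mxE.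
apply: eq_bigr => j _; rewrite !mxE; congr (_ * _).
by apply: eq_bigr => k _; rewrite !mxE.
Qed.

Lemma trace_psd_ge0 n (S X : 'M[R]_n) :
  possemidef S -> posdef X -> 0 <= \tr (S *m X).
Proof.
move=> [_ S0] /cholesky[V _ ->]; rewrite trace_gram.
by apply: sumr_ge0 => i _.
Qed.

Lemma trace_bound n (S : 'M[R]_n) :
  exists2 c, 0 <= c & forall X, posdef X -> `|\tr (S *m X)| <= c * \tr X.
Proof.
have [c c0 cS] := qform_bound S; exists c => // X /cholesky[V _ ->].
rewrite -[V^T *m V in leRHS]mul1mx !trace_gram mulr_sumr.
by apply: (le_trans (ler_norm_sum _ _ _)); apply: ler_sum.
Qed.

Lemma trace_conj_gt0 n p (S : 'M[R]_n) (X : 'M[R]_p) (D : 'M[R]_(n, p)) :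
  posdef S -> posdef X -> D != 0 -> 0 < \tr (S *m (D *m X *m D^T)).
Proof.
move=> Spd /cholesky[V Vu ->] D0.
have -> : D *m (V^T *m V) *m D^T = (V *m D^T)^T *m (V *m D^T).
  by rewrite trmx_mul trmxK !mulmxA.
have Spsd := posdef_psd Spd.
rewrite trace_gram lt_neqAle eq_sym sumr_ge0 ?andbT => [|i _]; last exact: Spsd.2.
apply: contra_neq D0 => /eqP; rewrite psumr_eq0 => [/allP S0|i _]; last first.
  by rewrite Spsd.2.
suff VD0 : V *m D^T = 0.
  by apply: trmx_inj; rewrite trmx0 -(mulKmx Vu D^T) VD0 mulmx0.
apply/row_matrixP => i; rewrite row0; apply: trmx_inj; rewrite trmx0.
by apply: (posdef_eq0 Spd); apply/eqP/S0; rewrite mem_index_enum.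
Qed.

End Quadratic.

(** * Vanishing sequences of matrices and the Stein equation *)

Section Vanishing.
Context {R : realType}.

(** Convergence to zero is taken entry by entry, which avoids choosing a norm. *)
Definition vanishes p q (u : nat -> 'M[R]_(p, q)) :=
  forall i j, u t i j @[t --> \oo] --> (0 : R).

(** Equivalent to a spectral radius less than one, without reference to complex
eigenvalues. *)
Definition stable n (A : 'M[R]_n) := vanishes (fun t => A ^+ t).

Lemma vanishes_ext p q (u v : nat -> 'M[R]_(p, q)) :
  u =1 v -> vanishes u -> vanishes v.
Proof. by move=> /funext ->. Qed.

Lemma vanishesD p q (u v : nat -> 'M[R]_(p, q)) :
  vanishes u -> vanishes v -> vanishes (fun t => u t + v t).
Proof.
move=> u0 v0 i j; under eq_fun do rewrite mxE.
by rewrite -[0]addr0; apply: cvgD.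
Qed.

Lemma cvg0_sum (I : Type) (s : seq I) (F : I -> nat -> R) :
  (forall i, F i @ \oo --> (0 : R)) ->
  \sum_(i <- s) F i t @[t --> \oo] --> (0 : R).
Proof.
move=> F0; elim: s => [|i s IH].
  by under eq_fun do rewrite big_nil; apply: cvg_cst.
under eq_fun do rewrite big_cons.
by have h := cvgD (F0 i) IH; rewrite addr0 in h; exact: h.
Qed.

Lemma vanishesM p q r (u : nat -> 'M[R]_(p, q)) (v : nat -> 'M[R]_(q, r)) :
  vanishes u -> vanishes v -> vanishes (fun t => u t *m v t).
Proof.
move=> u0 v0 i j; under eq_fun do rewrite mxE.
by apply: cvg0_sum => k; rewrite -[0](mulr0 0); apply: cvgM.
Qed.

Lemma vanishesMl p q r (M : 'M[R]_(p, q)) (v : nat -> 'M[R]_(q, r)) :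
  vanishes v -> vanishes (fun t => M *m v t).
Proof.
move=> v0 i j; under eq_fun do rewrite mxE.
by apply: cvg0_sum => k; rewrite -[0](mulr0 (M i k)); apply: cvgMr.
Qed.

Lemma vanishes_tr p q (u : nat -> 'M[R]_(p, q)) :
  vanishes u -> vanishes (fun t => (u t)^T).
Proof. by move=> u0 i j; under eq_fun do rewrite mxE; apply: u0. Qed.

Lemma vanishesMr p q r (u : nat -> 'M[R]_(p, q)) (M : 'M[R]_(q, r)) :
  vanishes u -> vanishes (fun t => u t *m M).
Proof.
move=> u0; apply: (@vanishes_ext _ _ (fun t => (M^T *m (u t)^T)^T)).
  by move=> t; rewrite trmx_mul !trmxK.
exact/vanishes_tr/vanishesMl/vanishes_tr.
Qed.

Lemma vanishesS p q (u : nat -> 'M[R]_(p, q)) :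
  vanishes u -> vanishes (fun t => u t.+1).
Proof. by move=> u0 i j; have := u0 i j;
  rewrite -(cvg_shiftS (fun t => u t i j)).
Qed.

Lemma vanishes_mxtrace p (u : nat -> 'M[R]_p) :
  vanishes u -> \tr (u t) @[t --> \oo] --> (0 : R).
Proof. by move=> u0; apply: cvg0_sum. Qed.

Lemma vanishes_cst p q (M : 'M[R]_(p, q)) : vanishes (fun=> M) -> M = 0.
Proof.
move=> M0; apply/matrixP => i j; rewrite mxE.
by apply: cvg_unique (M0 i j); [exact: norm_hausdorff|exact: cvg_cst].
Qed.

(** Iterating the equation gives D = (A^t)^T D B^t for all t. *)
Lemma stable_iter n (A B D : 'M[R]_n) :
  stable A -> stable B -> D = A^T *m D *m B -> D = 0.
Proof.
move=> As Bs eqD; apply: vanishes_cst.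
apply: (@vanishes_ext _ _ (fun t => ((A ^+ t)^T *m D) *m B ^+ t)); last first.
  by apply: vanishesM => //; apply/vanishesMr/vanishes_tr.
elim=> [|t IH]; first by rewrite !expr0 trmx1 mul1mx mulmx1.
by rewrite -[RHS]IH {2}eqD !exprS -!mulmxE trmx_mul !mulmxA.
Qed.

(** The equation is linear in P on a space of finite dimension, so that it is
enough that the homogeneous equation has only the zero solution, which is
stable_iter. *)
Lemma stein_exists n (A S : 'M[R]_n) :
  stable A -> exists P, P = S + A^T *m P *m A.
Proof.
move=> As; pose L : 'M[R]_(n * n) := 1%:M - lin_mulmx A^T *m lin_mulmxr A.
have LE P : mxvec P *m L = mxvec (P - A^T *m P *m A).
  by rewrite mulmxBr mulmx1 mulmxA !mul_vec_lin linearB.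
have Lu : L \in unitmx.
  rewrite -row_free_unit; apply: inj_row_free => v; rewrite -[v]vec_mxK LE.
  move=> /(congr1 vec_mx); rewrite mxvecK [RHS]linear0 => /subr0_eq P0.
  by rewrite (stable_iter As As P0) linear0.
exists (vec_mx (mxvec S *m invmx L)); set P := vec_mx _.
suff -> : S = P - A^T *m P *m A by rewrite subrK.
by apply: (can_inj mxvecK); rewrite -LE vec_mxK mulmxKV.
Qed.

Lemma stein_unroll n (A S P : 'M[R]_n) t :
  P = S + A^T *m P *m A ->
  P = \sum_(s < t) (A ^+ s)^T *m S *m A ^+ s + (A ^+ t)^T *m P *m A ^+ t.
Proof.
move=> PE; elim: t => [|t IH].
  by rewrite big_ord0 add0r !expr0 trmx1 mul1mx mulmx1.
rewrite {1}IH big_ord_recr /= -addrA; congr (_ + _).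
rewrite {1}PE mulmxDr mulmxDl exprS -!mulmxE trmx_mul.
by rewrite !mulmxA.
Qed.

Lemma stein_unique n (A S P P' : 'M[R]_n) : stable A ->
  P = S + A^T *m P *m A -> P' = S + A^T *m P' *m A -> P = P'.
Proof.
move=> As PE PE'; apply/subr0_eq/(stable_iter As As).
by rewrite {1}PE {1}PE' mulmxBr mulmxBl opprD addrACA subrr add0r.
Qed.

Lemma stein_sym n (A S P : 'M[R]_n) : stable A -> S^T = S ->
  P = S + A^T *m P *m A -> P^T = P.
Proof.
move=> As Ss PE; apply: (stein_unique As _ PE).
by rewrite {1}PE linearD /= Ss !trmx_mul trmxK mulmxA.
Qed.

Lemma qform_vanish n p (M : 'M[R]_p) (u : nat -> 'M[R]_(p, n)) v :
  vanishes u -> qform M (u t *m v) @[t --> \oo] --> (0 : R).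
Proof.
move=> u0; apply: (@vanishes_ext _ _ (fun t => (u t *m v)^T *m M *m (u t *m v))).
  by [].
by apply: vanishesM; [apply/vanishesMr/vanishes_tr|]; apply: vanishesMr.
Qed.

Lemma qform_sum n (I : Type) (s : seq I) (F : I -> 'M[R]_n) v :
  qform (\sum_(i <- s) F i) v = \sum_(i <- s) qform (F i) v.
Proof.
elim: s => [|i s IH]; first by rewrite !big_nil /qform mulmx0 mul0mx mxE.
by rewrite !big_cons qformD IH.
Qed.

(** Only S itself is kept from the series of the (F^t)^T S F^t. *)
Lemma stein_ge n (A S P : 'M[R]_n) : stable A -> possemidef S ->
  P = S + A^T *m P *m A -> forall v, qform S v <= qform P v.
Proof.
move=> As [_ S0] PE v; rewrite PE qformD lerDl qform_conj.
move: (A *m v) => {}v.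
have /cvgP h := qform_vanish P v As.
rewrite -(cvg_lim _ (qform_vanish P v As)) //.
apply: limr_le => //; near=> t; rewrite -qform_conj.
rewrite [leRHS](congr1 (fun M => qform M v) (stein_unroll t PE)).
rewrite qformD lerDr qform_sum sumr_ge0 // => i _.
by rewrite qform_conj.
Unshelve. all: by end_near. Qed.

Lemma stein_psd n (A S P : 'M[R]_n) : stable A -> possemidef S ->
  P = S + A^T *m P *m A -> possemidef P.
Proof.
move=> As Sp PE; split; first exact: stein_sym As Sp.1 PE.
by move=> v; apply: le_trans (stein_ge As Sp PE v); apply: Sp.2.
Qed.

Lemma stein_posdef n (A S P : 'M[R]_n) : stable A -> posdef S ->
  P = S + A^T *m P *m A -> posdef P.
Proof.
move=> As Sp PE; split; first exact: stein_sym As Sp.1 PE.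
move=> v v0; apply: lt_le_trans (stein_ge As (posdef_psd Sp) PE v).
exact: Sp.2.
Qed.

Lemma stable_tr n (A : 'M[R]_n) : stable A -> stable A^T.
Proof.
move=> /vanishes_tr; apply: vanishes_ext => t.
elim: t => [|t IH]; first by rewrite !expr0 trmx1.
by rewrite exprS exprSr -!mulmxE trmx_mul IH.
Qed.

(** The stage costs |Y F^t v|^2 sum to at most the value of P at v, so they
form a convergent series. *)
Lemma gram_vanishes n p (P F : 'M[R]_n) (Y : 'M[R]_(p, n)) :
  possemidef P -> P = Y^T *m Y + F^T *m P *m F -> vanishes (fun t => Y *m F ^+ t).
Proof.
move=> [_ P0] PE i j.
pose x t := F ^+ t *m (delta_mx j 0 : 'cV[R]_n).
pose g t := qform (Y^T *m Y) (x t).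
have g0 t : 0 <= g t by apply: qform_gram_ge0.
have gb N : series g N <= qform P (x 0%N).
  rewrite (stein_unroll N PE) qformD /series /= big_mkord.
  rewrite (_ : qform _ _ = \sum_(s < N) g s); last first.
    rewrite qform_sum; apply: eq_bigr => s _.
    by rewrite qform_conj /g /x expr0 mul1mx.
  by rewrite lerDl qform_conj.
have gs : cvgn (series g).
  apply: nondecreasing_is_cvgn.
    by apply/nondecreasing_seqP => t; rewrite seriesSr lerDl.
  by exists (qform P (x 0%N)) => _ [N _ <-].
have gc := cvg_series_cvg_0 gs.
apply/cvgr0Pnorm_lt => e e0.
have e20 : 0 < e ^+ 2 by rewrite exprn_gt0.
move/cvgr0Pnorm_lt: gc => /(_ _ e20); apply: filterS => t.
rewrite ger0_norm // /g qform_gram => lt.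
rewrite -(@ltr_pXn2r _ 2) ?nnegrE ?(ltW e0) // real_normK ?num_real //.
apply: le_lt_trans lt.
have -> : (Y *m F ^+ t) i j = (Y *m x t) i 0.
  by rewrite /x mulmxA -colE [RHS]mxE.
rewrite (bigD1 i) //= lerDl sumr_ge0 // => k _.
by rewrite sqr_ge0.
Qed.

(** Zero value means that every stage cost is zero. *)
Lemma gram_unobservable n p (P F : 'M[R]_n) (Y : 'M[R]_(p, n)) v :
  possemidef P -> P = Y^T *m Y + F^T *m P *m F -> qform P v = 0 ->
  forall t, Y *m F ^+ t *m v = 0.
Proof.
move=> [_ P0] PE Pv t.
have qP w : qform P w = 0 -> Y *m w = 0 /\ qform P (F *m w) = 0.
  rewrite {1}PE qformD qform_conj => /eqP.
  by rewrite paddr_eq0 ?qform_gram_ge0 // => /andP[/eqP/qform_gram_eq0 ? /eqP ?].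
have Pt : qform P (F ^+ t *m v) = 0.
  elim: t => [|t IH]; first by rewrite expr0 mul1mx.
  by rewrite exprS -mulmxE -mulmxA; apply: (qP _ IH).2.
by rewrite -mulmxA; apply: (qP _ Pt).1.
Qed.

End Vanishing.

(** * Powers of a matrix of spectral radius less than one *)

Section Spectral.
Context {R : realType}.
Import ComplexField.Normc.

(** After the perturbation b has become small against 1 - r, the sequence a
decays geometrically up to half of the tolerance. *)
Lemma contraction_cvg0 (r : R) (a b : nat -> R) : 0 <= r < 1 ->
  (forall t, 0 <= a t) -> (forall t, a t.+1 <= r * a t + b t) ->
  b @ \oo --> (0 : R) -> a @ \oo --> (0 : R).
Proof.
move=> /andP[r0 r1] a0 ab b0; apply/cvgr0Pnorm_lt => e e0.
have e1 : 0 < e * (1 - r) / 2 by rewrite divr_gt0 // mulr_gt0 // subr_gt0.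
move/cvgr0Pnorm_lt: b0 => /(_ _ e1)[N _ bN].
have aN k : a (k + N)%N <= r ^+ k * a N + e / 2.
  elim: k => [|k IH]; first by rewrite expr0 mul1r lerDl divr_ge0 ?ltW.
  rewrite addSn; apply: (le_trans (ab _)).
  have bk : b (k + N)%N <= e * (1 - r) / 2.
    by apply: (le_trans (ler_norm _)); apply/ltW/bN; rewrite /= leq_addl.
  have := ler_wpM2l r0 IH; rewrite exprS; lra.
have /cvgr0Pnorm_lt/(_ (e / 2) ltac:(lra))[M _ rM] :
    (fun k => a N * r ^+ k) @ \oo --> (0 : R).
  by rewrite -(mulr0 (a N)); apply: cvgMr; apply: cvg_expr; rewrite ger0_norm.
exists (M + N)%N => // t /= Mt; rewrite ger0_norm //.
have Nt : (N <= t)%N by apply: leq_trans Mt; rewrite leq_addl.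
have Mt' : (M <= t - N)%N by rewrite leq_subRL // addnC.
rewrite -(subnK Nt); apply: (le_lt_trans (aN _)).
have := le_lt_trans (ler_norm _) (rM _ Mt').
lra.
Qed.

Lemma normcB_le (x y : R[i]) : normc x <= normc y + normc (x - y).
Proof. by rewrite -{1}(subrK y x) addrC; apply: le_normcD. Qed.

Lemma normc_nonneg (x : R[i]) : 0 <= normc x.
Proof. by case: x => a b; rewrite sqrtr_ge0. Qed.

(** The entries of M^t p(M), with p a product of factors X - z, satisfy a
first-order recurrence of ratio z for each factor: if the sequence built from
(X - z) p vanishes, then so does the one built from p. Starting from an
annihilating polynomial, the factors can be peeled off one by one. *)
Lemma annihilated_powers_vanish n (M : 'M[R[i]]_n.+1) (s : seq R[i]) :
  (forall z, z \in s -> normc z < 1) ->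
  horner_mx M (\prod_(z <- s) ('X - z%:P)) = 0 ->
  forall i j, normc ((M ^+ t) i j) @[t --> \oo] --> (0 : R).
Proof.
move=> s1 Ms0.
suff H : forall i j, normc ((M ^+ t * 1) i j) @[t --> \oo] --> (0 : R).
  by move=> i j; under eq_fun do rewrite -[M ^+ _]mulr1; apply: H.
have : forall i j, normc ((M ^+ t *
    horner_mx M (\prod_(z <- s) ('X - z%:P))) i j) @[t --> \oo] --> (0 : R).
  move=> i j; rewrite Ms0; under eq_fun do rewrite mulr0 mxE normc0.
  exact: cvg_cst.
elim: s s1 {Ms0} => [|z s IH] s1 Ms0.
  by move: Ms0; rewrite big_nil rmorph1.
apply: IH => [w ws|i j]; first by rewrite s1 // in_cons ws orbT.
move: (Ms0 i j); rewrite big_cons rmorphM rmorphB /= horner_mx_X horner_mx_C.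
move: (horner_mx _ _) => D.
apply: (contraction_cvg0 (r := normc z)) => [|t|t].
- by rewrite normc_nonneg s1 // mem_head.
- exact: normc_nonneg.
- apply: (le_trans (normcB_le _ (z * (M ^+ t * D) i j))).
  rewrite normcM lerD2l le_eqVlt; apply/orP; left; apply/eqP; congr normc.
  rewrite mulrBl mulrBr mulrA -exprSr [in RHS]mxE; congr (_ + _).
  by rewrite [in RHS]mxE -!mulmxE mul_scalar_mx -scalemxAr [in RHS]mxE.
Qed.

(** The characteristic polynomial annihilates M by the Cayley-Hamilton theorem
and its roots are the eigenvalues. *)
Lemma spectral_radius_stable n (M : 'M[R]_n) : spectral_radius M < 1 -> stable M.
Proof.
case: n M => [|n] M rho; first by move=> -[].
pose Mc := map_mx (real_complex R) M.
have [s sE] := closed_field_poly_normal (char_poly Mc).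
move: sE; rewrite (monicP (char_poly_monic Mc)) scale1r => sE.
have eigs z : z \in s = eigenvalue Mc z.
  by rewrite eigenvalue_root_char sE root_prod_XsubC.
have s1 z : z \in s -> normc z < 1.
  move=> zs; apply: le_lt_trans rho; apply: ub_le_sup; last first.
    by exists z => //=; rewrite -eigs.
  (* finitely many moduli: their sum bounds the set whose supremum is rho *)
  exists (\sum_(w <- s) normc w) => _ [w /= + <-].
  rewrite -[eigenvalue _ _]eigs => ws.
  rewrite (big_rem _ ws) /= lerDl sumr_ge0 // => ? _; exact: normc_nonneg.
have := annihilated_powers_vanish s1 (_ : horner_mx Mc _ = 0).
rewrite -sE Cayley_Hamilton => /(_ erefl) Mc0 i j.
apply/norm_cvg0P; move: (Mc0 i j).
rewrite (_ : (fun t => _) = fun t => `|(M ^+ t) i j|) //.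
apply/funext => t; rewrite -(rmorphXn (map_mx (real_complex R))) mxE /normc /=.
by rewrite expr0n /= addr0 sqrtr_sqr.
Qed.
End Spectral.

(** * Riccati equations *)

Section Riccati.
Context {R : realType}.

(** Full column rank of the observability matrix is used only through a left
inverse, both to conclude that a vector is zero and that a sequence vanishes. *)
Lemma observable_left_inverse n d (C : 'M[R]_(d, n)) (A : 'M[R]_n) :
  observable C A -> exists L, L *m \mxcol_(i < n) (C *m A ^+ i) = 1%:M.
Proof.
move=> obs; exists (pinvmx (\mxcol_(i < n) (C *m A ^+ i))).
by apply: mulVpmx; rewrite /row_full obs.
Qed.

Lemma observable_eq0 n d p (C : 'M[R]_(d, n)) (A : 'M[R]_n) (v : 'M[R]_(n, p)) :
  observable C A -> (forall t, C *m A ^+ t *m v = 0) -> v = 0.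
Proof.
move=> /observable_left_inverse[L LO] Cv.
rewrite -[v]mul1mx -LO -mulmxA mxcol_mul.
rewrite (_ : \mxcol_i _ = 0) ?mulmx0 //.
by rewrite -(mxcol0 _); apply: eq_mxcol => i; apply: Cv.
Qed.

Lemma observable_vanishes n d p (C : 'M[R]_(d, n)) (A : 'M[R]_n)
    (u : nat -> 'M[R]_(n, p)) :
  observable C A -> (forall k, vanishes (fun t => C *m A ^+ k *m u t)) ->
  vanishes u.
Proof.
move=> /observable_left_inverse[L LO] Cu.
apply: (@vanishes_ext _ _ _
    (fun t => L *m (\mxcol_(i < n) (C *m A ^+ i *m u t)))) => [t|].
  by rewrite -mxcol_mul mulmxA LO mul1mx.
apply: vanishesMl => i j; under eq_fun do rewrite mxE.
exact: Cu.
Qed.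

Section Gain.
Variables (n m : nat) (A Q : 'M[R]_n) (B : 'M[R]_(n, m)) (W : 'M[R]_m).

Let K S := control_gain A B W S.
Let F S := A - B *m K S.

Lemma control_gainE S : W + B^T *m S *m B \in unitmx ->
  (W + B^T *m S *m B) *m K S = B^T *m S *m A.
Proof. by move=> Su; rewrite /K /control_gain !mulmxA mulmxV // mul1mx. Qed.

(** The quadratic term of the Riccati equation is absorbed by the closed-loop
matrix. *)
Lemma control_riccatiF S : S = Q + A^T *m S *m F S <-> control_riccati A B Q W S.
Proof.
by rewrite /control_riccati /F /K /control_gain mulmxBr !mulmxA addrA.
Qed.

(** Moving B^T S B K to the other side of the defining equation of the gain. *)
Lemma control_gainW S : W + B^T *m S *m B \in unitmx ->
  W *m K S = B^T *m S *m F S.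
Proof.
move=> /control_gainE; rewrite mulmxDl => KE.
by rewrite mulmxBr -KE !mulmxA addrK.
Qed.

Lemma control_riccati_lyapunov S : S^T = S -> W^T = W ->
  W + B^T *m S *m B \in unitmx -> control_riccati A B Q W S ->
  S = Q + (K S)^T *m W *m K S + (F S)^T *m S *m F S.
Proof.
move=> Ss Ws Su /control_riccatiF SE.
rewrite {1}SE -addrA; congr (_ + _).
have -> : (F S)^T = A^T - (K S)^T *m B^T.
  by rewrite linearB /= trmx_mul.
have -> : (K S)^T *m W *m K S = (K S)^T *m B^T *m S *m F S.
  by rewrite -mulmxA control_gainW // !mulmxA.
by rewrite !mulmxBl addrC subrK.
Qed.

(** The equation of S is used in the form S = Q + F^T S A and that of the other
solution as S' = Q + A^T S' F'; the cross terms produced by the feedbacks are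
both equal to K^T W K'. *)
Lemma riccati_difference S S' : S^T = S -> W^T = W -> Q^T = Q ->
  W + B^T *m S *m B \in unitmx -> W + B^T *m S' *m B \in unitmx ->
  control_riccati A B Q W S -> control_riccati A B Q W S' ->
  S - S' = (F S)^T *m (S - S') *m F S'.
Proof.
move=> Ss Ws Qs Su Su' /control_riccatiF SE /control_riccatiF SE'.
have E1 : S = Q + (F S)^T *m S *m A.
  by rewrite -[LHS]Ss {1}SE linearD /= Qs !trmx_mul trmxK Ss mulmxA.
have E2 : (F S)^T *m S *m B = (K S)^T *m W.
  apply: trmx_inj; rewrite trmx_mul (trmx_mul _ S) trmxK Ss (trmx_mul _ W) Ws.
  by rewrite trmxK control_gainW // mulmxA.
have E3 : (F S)^T *m S *m F S' = (F S)^T *m S *m A - (K S)^T *m W *m K S'.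
  by rewrite {2}/F mulmxBr [_ *m (B *m _)]mulmxA E2.
have E4 : (F S)^T *m S' *m F S' = A^T *m S' *m F S' - (K S)^T *m W *m K S'.
  rewrite -(mulmxA _ W) control_gainW //.
  have -> : (F S)^T = A^T - (K S)^T *m B^T by rewrite linearB /= (trmx_mul B).
  by rewrite (mulmxBl _ _ S') (mulmxBl _ _ (F S')) !mulmxA.
rewrite (mulmxBr (F S)^T) (mulmxBl _ _ (F S')) E3 E4 {1}E1 {1}SE'.
by mx_abel.
Qed.

Lemma riccati_unique S S' : S^T = S -> W^T = W -> Q^T = Q ->
  W + B^T *m S *m B \in unitmx -> W + B^T *m S' *m B \in unitmx ->
  stable (F S) -> stable (F S') ->
  control_riccati A B Q W S -> control_riccati A B Q W S' -> S = S'.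
Proof.
move=> Ss Ws Qs Su Su' Fs Fs' SE SE'; apply/subr0_eq.
exact: (stable_iter Fs Fs' (riccati_difference Ss Ws Qs Su Su' SE SE')).
Qed.

Lemma control_weight_posdef S : posdef W -> possemidef S ->
  posdef (W + B^T *m S *m B).
Proof. by move=> Wpd Sp; apply: posdefD => //; apply: psd_conj. Qed.

(** Writing the weights as Gram matrices turns the closed-loop cost into the
squared norm of one output, as gram_vanishes and gram_unobservable require. *)
Lemma riccati_gram d (V : 'M[R]_m) (Y : 'M[R]_(d, n)) S :
  Q = Y^T *m Y -> W = V^T *m V -> S^T = S ->
  W + B^T *m S *m B \in unitmx -> control_riccati A B Q W S ->
  S = (col_mx Y (V *m K S))^T *m col_mx Y (V *m K S) + (F S)^T *m S *m F S.
Proof.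
move=> QE WE Ss Su SE; have Ws : W^T = W by rewrite WE trmx_mul trmxK.
rewrite {1}(control_riccati_lyapunov Ss Ws Su SE); congr (_ + _).
by rewrite tr_col_mx mul_row_col QE WE (trmx_mul V) !mulmxA.
Qed.

(** Both Y x_t and K x_t tend to zero along x_t = F^t x. As A x_t = x_(t+1) + B
K x_t, induction on k gives Y A^k x_t -> 0 for every k, and observability
concludes. *)
Lemma riccati_stabilizing d (V : 'M[R]_m) (Y : 'M[R]_(d, n)) S :
  Q = Y^T *m Y -> W = V^T *m V -> V \in unitmx -> observable Y A ->
  possemidef S ->
  W + B^T *m S *m B \in unitmx -> control_riccati A B Q W S -> stable (F S).
Proof.
move=> QE WE Vu obs Sp Su SE.
have Z0 := gram_vanishes Sp (riccati_gram QE WE Sp.1 Su SE).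
have Y0 : vanishes (fun t => Y *m F S ^+ t).
  move=> i j; have := Z0 (lshift _ i) j.
  by under eq_fun do rewrite mul_col_mx col_mxEu.
have K0 : vanishes (fun t => K S *m F S ^+ t).
  apply: (@vanishes_ext _ _ _ (fun t => invmx V *m (V *m K S *m F S ^+ t))).
    by move=> t; rewrite -mulmxA mulKmx.
  apply: vanishesMl => i j; have := Z0 (rshift _ i) j.
  by under eq_fun do rewrite mul_col_mx col_mxEd.
apply: (observable_vanishes obs); elim=> [|k IH].
  by apply: vanishes_ext Y0 => t; rewrite expr0 mulmx1.
apply: (@vanishes_ext _ _ _ (fun t => Y *m A ^+ k *m F S ^+ t.+1
    + Y *m A ^+ k *m B *m (K S *m F S ^+ t))); last first.
  by apply: vanishesD; [apply: vanishesS IH|apply: vanishesMl].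
move=> t; rewrite [in LHS]exprS exprSr -!mulmxE !mulmxA -mulmxDl.
by congr (_ *m _); rewrite {1}/F mulmxBr !mulmxA subrK.
Qed.

(** If x has value zero, then K x_t = 0 for all t, so the closed loop follows
the open loop and Y A^t x = 0. *)
Lemma riccati_posdef d (V : 'M[R]_m) (Y : 'M[R]_(d, n)) S :
  Q = Y^T *m Y -> W = V^T *m V -> V \in unitmx -> observable Y A ->
  possemidef S ->
  W + B^T *m S *m B \in unitmx -> control_riccati A B Q W S -> posdef S.
Proof.
move=> QE WE Vu obs Sp Su SE; apply: psd_posdef => // v Sv.
have Z0 := gram_unobservable Sp (riccati_gram QE WE Sp.1 Su SE) Sv.
have YK t : Y *m F S ^+ t *m v = 0 /\ K S *m F S ^+ t *m v = 0.
  move: (Z0 t); rewrite !mul_col_mx -[0 in RHS]col_mx0 => /eq_col_mx[-> VK].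
  split=> //; rewrite -(mulKmx Vu (K S *m _ *m _)) -!mulmxA !(mulmxA V) in VK *.
  by rewrite VK mulmx0.
have FA t : F S ^+ t *m v = A ^+ t *m v.
  elim: t => [|t IH]; first by rewrite !expr0.
  rewrite !exprS -!mulmxE -!mulmxA -IH {1}/F mulmxBl -(mulmxA B).
  by rewrite (mulmxA (K S)) (YK t).2 mulmx0 subr0.
apply: (observable_eq0 obs) => t.
by rewrite -mulmxA -FA mulmxA (YK t).1.
Qed.

End Gain.
End Riccati.

(** * The cost as a trace *)

Section Cost.
Context {R : realType} {n m d : nat}.
Variables (A : 'M[R]_n) (B : 'M[R]_(n, m)) (C : 'M[R]_(d, n)).
Variables (Q : 'M[R]_n) (Rw : 'M[R]_m).

(** Block form of the matrix Abar + Bbar K Cbar. *)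
Definition closed_loop (CK : 'M[R]_(m, n)) (BK : 'M[R]_(n, d)) (AK : 'M[R]_n) :
    'M[R]_(n + n) :=
  block_mx A (B *m CK) (BK *m C) AK.

(** The matrix of the stage cost as a quadratic form in the pair (x, xi). *)
Definition cost_weight (CK : 'M[R]_(m, n)) : 'M[R]_(n + n) :=
  block_mx Q 0 0 (CK^T *m Rw *m CK).

Lemma closed_loopE CK BK AK :
  Abar A + Bbar B *m controller CK BK AK *m Cbar C = closed_loop CK BK AK.
Proof.
rewrite /Abar /Bbar /Cbar /controller !mulmx_block add_block_mx.
by rewrite !(mulmx0, mul0mx, mul1mx, mulmx1, addr0, add0r).
Qed.

Lemma ctrlCE CK BK AK : ctrlC (@controller R n m d CK BK AK) = CK.
Proof. exact: block_mxKur. Qed.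
Lemma ctrlBE CK BK AK : ctrlB (@controller R n m d CK BK AK) = BK.
Proof. exact: block_mxKdl. Qed.
Lemma ctrlAE CK BK AK : ctrlA (@controller R n m d CK BK AK) = AK.
Proof. exact: block_mxKdr. Qed.

Lemma trajectoryE CK BK AK x0 xi0 t :
  let xt := trajectory A B C (controller CK BK AK) x0 xi0 t in
  col_mx xt.1 xt.2 = closed_loop CK BK AK ^+ t *m col_mx x0 xi0.
Proof.
elim: t => [|t IH] /=; first by rewrite expr0 mul1mx.
rewrite exprS -mulmxE -mulmxA -IH /=.
case: (trajectory _ _ _ _ _ _ _) => x xi /=.
by rewrite ctrlCE ctrlBE ctrlAE mul_block_col !mulmxA [AK *m _ + _]addrC.
Qed.

Lemma stage_costE CK BK AK x t :
  stage_cost A B C Q Rw (controller CK BK AK) (usubmx x) (dsubmx x) t =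
  qform ((closed_loop CK BK AK ^+ t)^T *m cost_weight CK
         *m closed_loop CK BK AK ^+ t) x.
Proof.
rewrite qform_conj -{3}[x]vsubmxK -trajectoryE /stage_cost.
case: (trajectory _ _ _ _ _ _ _) => y xi /=.
rewrite ctrlCE /qform tr_col_mx mul_row_block mul_row_col !mulmx0 addr0 add0r.
by rewrite [RHS]mxE trmx_mul !mulmxA.
Qed.

Section Moments.
Context {disp : measure_display} {Omega : measurableType disp}.
Variables (P : probability Omega R) (x : Omega -> 'cV[R]_(n + n)).
Hypothesis hmom : finite_second_moments P x.

Let integrable_mul i j :
  P.-integrable setT (fun w => (x w i ord0 * x w j ord0)%:E).
Proof. by apply/Lfun1_integrable; apply: Lfun2_mul_Lfun1; apply: hmom. Qed.

Lemma qform_pair p (M : 'M[R]_p) (v : 'cV[R]_p) :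
  qform M v = \sum_(ij : 'I_p * 'I_p) M ij.1 ij.2 * (v ij.1 0 * v ij.2 0).
Proof.
rewrite -(pair_big predT predT (fun i j => M i j * (v i 0 * v j 0))) /=.
rewrite /qform -mulmxA mxE; apply: eq_bigr => i _.
by rewrite mxE mxE mulr_sumr; apply: eq_bigr => j _; ring.
Qed.

Lemma mxtrace_pair p (M X : 'M[R]_p) :
  \tr (M *m X) = \sum_(ij : 'I_p * 'I_p) M ij.1 ij.2 * X ij.2 ij.1.
Proof.
rewrite -(pair_big predT predT (fun i j => M i j * X j i)) /=.
by apply: eq_bigr => i _; rewrite mxE.
Qed.

Let integrable_term (M : 'M[R]_(n + n)) (ij : 'I_(n + n) * 'I_(n + n)) :
  P.-integrable setT
    (fun w => (M ij.1 ij.2)%:E * (x w ij.1 ord0 * x w ij.2 ord0)%:E)%E.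
Proof. exact: integrableZl. Qed.

Lemma integrable_qform M : P.-integrable setT (fun w => (qform M (x w))%:E).
Proof.
under eq_fun do rewrite qform_pair -sumEFin.
apply: integrable_sum => // ij _.
by under eq_fun do rewrite EFinM; apply: integrable_term.
Qed.

(** Second moments are finite, so the expectation of each monomial can be taken
separately. *)
Lemma integral_qform M :
  (\int[P]_w (qform M (x w))%:E = (\tr (M *m second_moment P x))%:E)%E.
Proof.
under eq_integral do rewrite qform_pair -sumEFin.
under eq_integral do under eq_bigr do rewrite EFinM.
rewrite integral_sum // mxtrace_pair -sumEFin; apply: eq_bigr => ij _.
rewrite integralZl // EFinM; congr (_ * _)%E; rewrite mxE fineK.
  by rewrite unlock; apply: eq_integral => w _; rewrite mulrC.
by rewrite unlock; apply: integrable_fin_num.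
Qed.

(** The stage costs are nonnegative, hence the expectation and the sum over
time commute. *)
Lemma dlqr_cost_series CK BK AK : possemidef Q -> posdef Rw ->
  dlqr_cost A B C Q Rw P x (controller CK BK AK) =
  (\sum_(0 <= t <oo) (\tr ((closed_loop CK BK AK ^+ t)^T *m cost_weight CK
         *m closed_loop CK BK AK ^+ t *m second_moment P x))%:E)%E.
Proof.
move=> Qp Rp; rewrite /dlqr_cost integral_nneseries //; last first.
- move=> t w _; rewrite lee_fin /stage_cost.
  case: (trajectory _ _ _ _ _ _ _) => y xi.
  by rewrite addr_ge0 ?Qp.2 // (posdef_psd Rp).2.
- move=> t; under eq_fun do rewrite stage_costE.
  exact: measurable_int (integrable_qform _).
apply: eq_eseriesr => t _; under eq_integral do rewrite stage_costE.
exact: integral_qform.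
Qed.

(** The partial sums telescope up to the term (F^N)^T S F^N, which vanishes. *)
Lemma dlqr_costE CK BK AK S : possemidef Q -> posdef Rw ->
  stable (closed_loop CK BK AK) ->
  S = cost_weight CK + (closed_loop CK BK AK)^T *m S *m closed_loop CK BK AK ->
  dlqr_cost A B C Q Rw P x (controller CK BK AK) =
  (\tr (S *m second_moment P x))%:E.
Proof.
move=> Qp Rp; set F := closed_loop _ _ _ => Fs SE.
rewrite dlqr_cost_series // -/F; apply/cvg_lim => //.
pose rest t := \tr ((F ^+ t)^T *m S *m F ^+ t *m second_moment P x).
rewrite (_ : (fun N => _) = fun N => (\tr (S *m second_moment P x) - rest N)%:E).
  apply: cvg_EFin; first exact: nearW.
  rewrite -[X in _ --> X]subr0; apply: cvgB; first exact: cvg_cst.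
  apply: vanishes_mxtrace; apply: vanishesMr; apply: vanishesM => //.
  exact/vanishesMr/vanishes_tr.
apply/funext => N; rewrite sumEFin big_mkord; congr EFin.
rewrite [in X in _ = X - _](stein_unroll N SE) /rest mulmxDl linearD /= addrK.
by rewrite mulmx_suml raddf_sum.
Qed.
End Moments.
End Cost.

(** * First variation of the cost *)

Section Perturbation.
Context {R : realType}.

(** The maps P |-> P - F^T P F and S |-> S - F S F^T are adjoint for the trace
pairing. *)
Lemma stein_duality k (F S X P Sg : 'M[R]_k) :
  P = S + F^T *m P *m F -> Sg = X + F *m Sg *m F^T ->
  \tr (P *m X) = \tr (S *m Sg).
Proof.
move=> PE SgE; have -> : X = Sg - F *m Sg *m F^T by rewrite {1}SgE addrK.
have -> : S = P - F^T *m P *m F by rewrite {1}PE addrK.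
rewrite mulmxBr mulmxBl !raddfB /=; congr (_ - _).
by rewrite !mulmxA mxtrace_mulC !mulmxA.
Qed.

Lemma stein_dual_exists k (F X : 'M[R]_k) : stable F ->
  exists Sg, Sg = X + F *m Sg *m F^T.
Proof.
by move=> /stable_tr /(stein_exists X)[Sg SgE]; exists Sg; rewrite trmxK in SgE.
Qed.

Lemma stein_dual_posdef k (F X Sg : 'M[R]_k) : stable F -> posdef X ->
  Sg = X + F *m Sg *m F^T -> posdef Sg.
Proof.
move=> /stable_tr Fs Xp SgE; apply: (stein_posdef Fs Xp).
by rewrite trmxK.
Qed.

(** For a definite M = V^T V, the vanishing of V F^t is that of F^t. *)
Lemma lyapunov_stable k (F M P : 'M[R]_k) : posdef M -> possemidef P ->
  P = M + F^T *m P *m F -> stable F.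
Proof.
move=> /cholesky[V Vu ->] Pp PE.
apply: (@vanishes_ext _ _ _ (fun t => invmx V *m (V *m F ^+ t))).
  by move=> t; rewrite mulKmx.
exact/vanishesMl/(gram_vanishes Pp PE).
Qed.

Lemma conj_expand k l (F D : 'M[R]_(k, l)) (S : 'M[R]_k) h :
  (F + h *: D)^T *m S *m (F + h *: D) =
  F^T *m S *m F + h *: (D^T *m S *m F + F^T *m S *m D)
  + h ^+ 2 *: (D^T *m S *m D).
Proof.
rewrite trmxD trmxZ !mulmxDl !mulmxDr -!scalemxAl -!scalemxAr.
by rewrite scalerDr scalerA -expr2 !addrA; congr (_ + _); apply: addrAC.
Qed.

(** Below this radius h is at most 1, so that h^2 terms are dominated by linear
ones, and a linear term of slope a loses at most one half. *)
Lemma small_step (a : R) : 0 <= a ->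
  exists2 r : R, 0 < r & forall h : R, `|h| < r -> `|h| <= 1 /\ `|h| * a <= 2^-1.
Proof.
move=> a0; exists (2 * (a + 1))^-1 => [|h hr].
  by rewrite invr_gt0; lra.
have a1 : 0 < a + 1 by lra.
have h0 := normr_ge0 h.
have : `|h| * (2 * (a + 1)) <= 1.
  by rewrite -ler_pdivlMr ?mul1r ?ltW // mulr_gt0.
split; nra.
Qed.

(** With P = 1 + F^T P F and h small, the decrease P - (F + h D)^T P (F + h D)
is still at least half of the identity, so P is a Lyapunov function common to
all F + h D; pairing the decrease with the state covariance bounds the trace of
the latter uniformly in h. *)
Lemma stable_perturbation k (F D X : 'M[R]_k) : stable F -> posdef X ->
  exists r b : R, [/\ 0 < r, 0 <= b & forall h, `|h| < r ->
    [/\ `|h| <= 1, stable (F + h *: D) &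
      forall Sg, Sg = X + (F + h *: D) *m Sg *m (F + h *: D)^T ->
      posdef Sg /\ \tr Sg <= b]].
Proof.
move=> Fs Xp; have [P PE] := stein_exists 1%:M Fs.
have Pp := stein_posdef Fs (posdef1 _) PE.
have [c1 c10 S1] := qform_bound (D^T *m P *m F + F^T *m P *m D).
have [c2 c20 S2] := qform_bound (D^T *m P *m D).
have [r r0 rP] := small_step (addr_ge0 c10 c20).
exists r, (2 * \tr (P *m X)); split=> // [|h hr].
  by rewrite mulr_ge0 // trace_psd_ge0 //; apply: posdef_psd.
have [h1 hc] := rP _ hr.
pose M := P - (F + h *: D)^T *m P *m (F + h *: D).
have Ms : M^T = M.
  by rewrite trmxB !(trmx_mul, trmxK) Pp.1 !mulmxA.
have Mge v : 2^-1 * qform 1%:M v <= qform M v.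
  rewrite /M conj_expand {1}PE -!addrA !qformD qformN !qformD !qformZ.
  have h0 := normr_ge0 h; have q0 := qform1_ge0 v.
  have h1v : h * qform (D^T *m P *m F + F^T *m P *m D) v <=
      `|h| * (c1 * qform 1%:M v).
    by apply: (le_trans (ler_norm _)); rewrite normrM ler_wpM2l.
  have h2v : h ^+ 2 * qform (D^T *m P *m D) v <= `|h| * (c2 * qform 1%:M v).
    apply: (le_trans (ler_norm _)); rewrite normrM normrX.
    by apply: ler_pM => //; rewrite expr2 ler_piMl.
  have := ler_wpM2r q0 hc; lra.
have Mp : posdef M.
  split=> // v v0; apply: lt_le_trans (Mge v).
  by rewrite mulr_gt0 ?invr_gt0 // (posdef1 _).2.
have PE' : P = M + (F + h *: D)^T *m P *m (F + h *: D) by rewrite subrK.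
have Fhs := lyapunov_stable Mp (posdef_psd Pp) PE'.
split=> // Sg SgE; have Sgp := stein_dual_posdef Fhs Xp SgE; split=> //.
rewrite (stein_duality PE' SgE).
have : possemidef (M - 2^-1 *: 1%:M).
  split; first by rewrite trmxB trmxZ trmx1 Ms.
  by move=> v; rewrite qformD qformN qformZ subr_ge0.
move=> /trace_psd_ge0/(_ Sgp); rewrite mulmxBl -scalemxAl mul1mx raddfB /=.
rewrite mxtraceZ; lra.
Qed.

(** By duality the difference of costs is tr (M S_h), where M, the defect of P
in the perturbed equation, is exactly h E + h^2 E2, and S_h is the perturbed
covariance. To replace S_h by S in the linear term, E is itself written as L -
F^T L F, and the same computation shows that the error is again of order h; the
uniform bound on tr S_h controls everything of second order. *)
Lemma cost_expansion k (F D W W1 W2 X P Sg : 'M[R]_k) :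
  stable F -> posdef X ->
  P = W + F^T *m P *m F -> Sg = X + F *m Sg *m F^T ->
  exists r c : R, 0 < r /\ forall h, `|h| < r -> stable (F + h *: D) /\
    forall Ph, Ph = (W + h *: W1 + h ^+ 2 *: W2)
                    + (F + h *: D)^T *m Ph *m (F + h *: D) ->
    `|\tr (Ph *m X) - \tr (P *m X)
      - h * \tr ((W1 + (D^T *m P *m F + F^T *m P *m D)) *m Sg)| <= c * h ^+ 2.
Proof.
move=> Fs Xp PE SgE.
have [r [b [r0 b0 rP]]] := stable_perturbation D Fs Xp.
set E := W1 + (D^T *m P *m F + F^T *m P *m D).
have [L LE] := stein_exists E Fs.
have [c1 c10 cE] := trace_bound (W2 + D^T *m P *m D).
have [c2 c20 cG] := trace_bound (D^T *m L *m F + F^T *m L *m D).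
have [c3 c30 cH] := trace_bound (D^T *m L *m D).
exists r, ((c1 + c2 + c3) * b); split=> // h hr.
have [h1 Fhs SgP] := rP _ hr; split=> // Ph PhE.
have [Sgh SghE] := stein_dual_exists X Fhs.
have [Sghp Sghb] := SgP _ SghE.
rewrite (stein_duality PhE SghE) -(stein_duality LE SgE).
have dual (S : 'M[R]_k) : \tr (S *m X) =
    \tr ((S - (F + h *: D)^T *m S *m (F + h *: D)) *m Sgh).
  by apply: stein_duality SghE; rewrite subrK.
rewrite (dual P) (dual L) !conj_expand.
set G := D^T *m L *m F + F^T *m L *m D.
have -> : L - (F^T *m L *m F + h *: G + h ^+ 2 *: (D^T *m L *m D)) =
    E - h *: G - h ^+ 2 *: (D^T *m L *m D).
  by rewrite {1}LE; mx_abel.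
rewrite -raddfB /= -mulmxBl.
have -> : W + h *: W1 + h ^+ 2 *: W2 - (P - (F^T *m P *m F +
    h *: (D^T *m P *m F + F^T *m P *m D) + h ^+ 2 *: (D^T *m P *m D))) =
    h *: E + h ^+ 2 *: (W2 + D^T *m P *m D).
  by rewrite {1}PE /E; mx_abel.
rewrite !mulmxBl mulmxDl -!scalemxAl !raddfB !raddfD /= !mxtraceZ.
have := cE _ Sghp; have := cG _ Sghp; have := cH _ Sghp.
rewrite -/G.
move: (\tr (E *m Sgh)) (\tr (G *m Sgh)) (\tr ((W2 + _) *m Sgh))
  (\tr (_ *m Sgh)) (\tr Sgh) Sghb.
move=> tE tG tD tL s sb H3 H2 H1.
have -> : h * tE + h ^+ 2 * tD - h * (tE - h * tG - h ^+ 2 * tL) =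
   h ^+ 2 * (tD + tG + h * tL) by ring.
rewrite normrM (ger0_norm (sqr_ge0 h)) mulrC ler_wpM2r ?sqr_ge0 //.
apply: (le_trans (ler_normD _ _)).
rewrite !mulrDl lerD //.
  apply: (le_trans (ler_normD _ _)).
  by apply: lerD; [apply: (le_trans H1)|apply: (le_trans H2)]; rewrite ler_wpM2l.
rewrite normrM; apply: (@le_trans _ _ `|tL|); first by rewrite ler_piMl.
by apply: (le_trans H3); rewrite ler_wpM2l.
Qed.

(** The difference quotients tend to e by the remainder bound, and to the
directional derivative, which is zero. *)
Lemma quadratic_remainder_derive0 (V : normedModType R) (f : V -> R) (a v : V)
    (e c r : R) :
  differentiable f a -> 'D_v f a = 0 -> 0 < r ->
  (forall h : R, `|h| < r -> `|f (a + h *: v) - f a - h * e| <= c * h ^+ 2) ->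
  e = 0.
Proof.
move=> df; have fd : derivable f a v by apply: diff_derivable.
rewrite /derive => D0 r0 bnd.
have D0c : h^-1 *: ((f \o shift a) (h *: v) - f a) @[h --> (0 : R)^'] --> (0 : R).
  by move: fd; rewrite /derivable /= -[X in _ --> X]/(lim _) D0.
apply/eqP; rewrite -normr_le0; apply/ler_addgt0Pl => eps eps0; rewrite addr0.
(* d bounds the slope error c h of the difference quotient by eps / 2 *)
have [d d0 dP] : exists2 d : R, 0 < d & d * `|c| <= eps / 2.
  exists (eps / 2 / (`|c| + 1)); first by rewrite !divr_gt0 // ltr_wpDl.
  have c0 := normr_ge0 c.
  rewrite mulrAC ler_pdivrMr ?ltr_wpDl // ler_wpM2l ?lerDl //.
  by rewrite divr_ge0 ?ltW.
move/cvgr0Pnorm_lt: D0c => /(_ (eps / 2)) D0c.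
near (0 : R)^' => h.
have h0 : h != 0 by near: h; exact: nbhs_dnbhs_neq.
have hr : `|h| < r by near: h; apply: dnbhs0_lt.
have hd : `|h| < d by near: h; apply: dnbhs0_lt.
have : `|h^-1 *: ((f \o shift a) (h *: v) - f a)| < eps / 2.
  by near: h; apply: D0c; rewrite divr_gt0.
rewrite /= [_ + a]addrC; have := bnd h hr.
move: (f _ - f a) => q.
rewrite -[X in q - X](mulrC e) => B1 B2.
have hp : 0 < `|h| by rewrite normr_gt0.
have -> : e = h^-1 * q - h^-1 * (q - e * h) by field.
apply: (le_trans (ler_normB _ _)).
suff : `|h^-1 * (q - e * h)| <= eps / 2.
  by move: B2; rewrite /GRing.scale /=; lra.
rewrite normrM normrV ?unitfE // mulrC ler_pdivrMr //.
apply: (le_trans B1); rewrite -(real_normK (num_real h)) expr2 mulrA ler_wpM2r //.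
apply: le_trans dP; rewrite mulrC; apply: (@le_trans _ _ (`|h| * `|c|)).
  by rewrite ler_wpM2l // ler_norm.
by rewrite ler_wpM2r // ltW.
Unshelve. all: by end_near. Qed.
End Perturbation.

Section Stationary.
Context {R : realType} {n m d : nat}.
Variables (A : 'M[R]_n) (B : 'M[R]_(n, m)) (C : 'M[R]_(d, n)).
Variables (Q : 'M[R]_n) (Rw : 'M[R]_m).
Context {disp : measure_display} {Omega : measurableType disp}.
Variables (Pr : probability Omega R) (x : Omega -> 'cV[R]_(n + n)).
Hypotheses (hQ : possemidef Q) (hR : posdef Rw).
Hypotheses (hmom : finite_second_moments Pr x) (hX : posdef (second_moment Pr x)).

Lemma cost_weight_psd (CK : 'M[R]_(m, n)) : possemidef (cost_weight Q Rw CK).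
Proof.
split.
  by rewrite tr_block_mx !trmx0 hQ.1 !trmx_mul trmxK hR.1 mulmxA.
move=> v; rewrite -[v]vsubmxK /qform tr_col_mx mul_row_block mul_row_col.
rewrite !mulmx0 addr0 add0r mxE -!/(qform _ _) qform_conj addr_ge0 ?hQ.2 //.
exact: (posdef_psd hR).2.
Qed.

Let J CK BK AK := fine (dlqr_cost A B C Q Rw Pr x (controller CK BK AK)).

Section Point.
Variables (CK : 'M[R]_(m, n)) (BK : 'M[R]_(n, d)) (AK : 'M[R]_n).
Let F := closed_loop A B C CK BK AK.
Variables (P Sg : 'M[R]_(n + n)).
Hypothesis Fs : stable F.
Hypothesis PE : P = cost_weight Q Rw CK + F^T *m P *m F.
Hypothesis SgE : Sg = second_moment Pr x + F *m Sg *m F^T.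
Let N := P *m F *m Sg.

(** The three directions act on the closed-loop matrix through block_mx 0 (B
DC) (DB C) DA; the gain of the controller also enters the weight, which
produces the last trace. The factor 2 is the symmetry of the linear term. *)
Lemma cost_variation DC DB DA : exists r c : R, 0 < r /\ forall h, `|h| < r ->
  `|J (CK + h *: DC) (BK + h *: DB) (AK + h *: DA) - J CK BK AK
    - h * (\tr ((block_mx 0 (B *m DC) (DB *m C) DA)^T *m N)
           + \tr (DC^T *m (Rw *m CK *m drsubmx Sg))) *+ 2| <= c * h ^+ 2.
Proof.
set D := block_mx _ _ _ _.
pose W1 : 'M[R]_(n + n) :=
  block_mx 0 0 0 (DC^T *m Rw *m CK + CK^T *m Rw *m DC).
pose W2 : 'M[R]_(n + n) := block_mx 0 0 0 (DC^T *m Rw *m DC).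
have [r [c [r0 rP]]] := cost_expansion D W1 W2 Fs hX PE SgE.
exists r, c; split=> // h /rP[]{rP}.
have FhE : F + h *: D =
    closed_loop A B C (CK + h *: DC) (BK + h *: DB) (AK + h *: DA).
  rewrite /F /closed_loop /D scale_block_mx add_block_mx scaler0 addr0.
  by rewrite mulmxDr mulmxDl -scalemxAl -scalemxAr.
have WhE : cost_weight Q Rw CK + h *: W1 + h ^+ 2 *: W2
    = cost_weight Q Rw (CK + h *: DC).
  rewrite /cost_weight /W1 /W2 !scale_block_mx !add_block_mx !scaler0 !addr0.
  by rewrite conj_expand.
rewrite FhE WhE => Fhs rP.
have [Ph PhE] := stein_exists (cost_weight Q Rw (CK + h *: DC)) Fhs.
have := rP _ PhE.
have Sgs := (stein_dual_posdef Fs hX SgE).1.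
have Ps := stein_sym Fs (cost_weight_psd CK).1 PE.
rewrite /J !(dlqr_costE hmom hQ hR _ PhE) // (dlqr_costE hmom hQ hR Fs PE) /=.
set e := \tr ((W1 + _) *m Sg); suff -> : e = (\tr (D^T *m N) +
   \tr (DC^T *m (Rw *m CK *m drsubmx Sg))) *+ 2 by rewrite mulrnAr.
have tr_sym k l (S : 'M[R]_k) (T : 'M[R]_l) (U V : 'M[R]_(k, l)) :
    S^T = S -> T^T = T -> \tr (U^T *m S *m V *m T) = \tr (V^T *m S *m U *m T).
  move=> Ss Ts; rewrite -mxtrace_tr !trmx_mul trmxK Ss Ts mxtrace_mulC.
  by rewrite !mulmxA.
have trW1 (M : 'M[R]_n) : \tr ((block_mx 0 0 0 M : 'M[R]_(n + n)) *m Sg) =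
    \tr (M *m drsubmx Sg).
  rewrite -{1}[Sg]submxK mulmx_block mxtrace_block !mul0mx !addr0 mxtrace0.
  by rewrite !add0r.
have Sg2s : (drsubmx Sg)^T = drsubmx Sg by rewrite trmx_drsub Sgs.
rewrite /e !mulmxDl !raddfD /= trW1 mulmxDl raddfD /=.
rewrite (tr_sym _ _ _ _ CK DC hR.1 Sg2s) (tr_sym _ _ _ _ F D Ps Sgs).
rewrite /N !mulmxA; ring.
Qed.

(** Vanishing of the partial derivatives along each elementary matrix reads off
one entry of the gradient at a time. *)
Lemma stationary_equations :
  stationary_points A B C Q Rw Pr x (controller CK BK AK) ->
  [/\ drsubmx N = 0, dlsubmx N *m C^T = 0 &
      B^T *m ursubmx N + Rw *m CK *m drsubmx Sg = 0].
Proof.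
rewrite /stationary_points /= ctrlAE ctrlBE ctrlCE -/J.
move=> [_ [dA gA] [dB gB] [dC gC]].
have tr_delta p q (M : 'M[R]_(p, q)) i j : \tr ((delta_mx i j)^T *m M) = M i j.
  rewrite trmx_delta -(mul_delta_mx (0 : 'I_1)) -mulmxA mxtrace_mulC.
  by rewrite -rowE -colE trace_mx11 !mxE.
have tr_dir (U V W : 'M[R]_n) : \tr ((block_mx 0 U V W)^T *m N) =
    \tr (V^T *m dlsubmx N) + \tr (U^T *m ursubmx N) + \tr (W^T *m drsubmx N).
  rewrite -{1}[N]submxK tr_block_mx mulmx_block mxtrace_block trmx0 mul0mx.
  by rewrite add0r raddfD addrA.
have vanish (V : normedModType R) (f : V -> R) (a v : V) (e : R) :
    differentiable f a -> 'D_v f a = 0 ->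
    (exists r c : R, 0 < r /\ forall h, `|h| < r ->
       `|f (a + h *: v) - f a - h * e *+ 2| <= c * h ^+ 2) -> e = 0.
  move=> df D0 [r [c [r0 bnd]]].
  suff : e *+ 2 = 0 by move/eqP; rewrite mulrn_eq0 => /eqP.
  apply: (quadratic_remainder_derive0 (c := c) df D0 r0) => h.
  by rewrite mulrnAr => /bnd.
split; apply/matrixP => i j; rewrite [RHS]mxE.
- apply: vanish dA _ _; first by move/matrixP/(_ i j): gA; rewrite !mxE; apply.
  have [r [c [r0 H]]] := cost_variation 0 0 (delta_mx i j).
  exists r, c; split=> // h /H.
  rewrite !scaler0 !addr0 mulmx0 mul0mx tr_dir !trmx0 !mul0mx mxtrace0.
  by rewrite tr_delta !add0r addr0.
- apply: vanish dB _ _; first by move/matrixP/(_ i j): gB; rewrite !mxE; apply.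
  have [r [c [r0 H]]] := cost_variation 0 (delta_mx i j) 0.
  exists r, c; split=> // h /H.
  rewrite !scaler0 !addr0 mulmx0 tr_dir !trmx0 !mul0mx mxtrace0 !addr0.
  by rewrite trmx_mul -mulmxA mxtrace_mulC -mulmxA tr_delta.
- apply: vanish dC _ _; first by move/matrixP/(_ i j): gC; rewrite !mxE; apply.
  have [r [c [r0 H]]] := cost_variation (delta_mx i j) 0 0.
  exists r, c; split=> // h /H.
  rewrite !scaler0 !addr0 mul0mx tr_dir !trmx0 !mul0mx mxtrace0 add0r addr0.
  have addE (M1 M2 : 'M[R]_(m, n)) : (M1 + M2) i j = M1 i j + M2 i j.
    by rewrite mxE.
  by rewrite trmx_mul -(mulmxA _ B^T) !tr_delta addE.
Qed.

End Point.
End Stationary.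

(** * Algebra of an observable stationary point *)

Section Structure.
Context {R : realType} {n m d : nat}.
Variables (A : 'M[R]_n) (B : 'M[R]_(n, m)) (C : 'M[R]_(d, n)).
Variables (Q : 'M[R]_n) (Rw : 'M[R]_m).
Variables (CK : 'M[R]_(m, n)) (BK : 'M[R]_(n, d)) (AK : 'M[R]_n).
Variables (P11 P12 P22 S11 S12 S22 X11 X12 X22 : 'M[R]_n).
Let F := closed_loop A B C CK BK AK.
Let P := block_mx P11 P12 P12^T P22.
Let Sg := block_mx S11 S12 S12^T S22.
Let X := block_mx X11 X12 X12^T X22.
(* The matrices below are variables with defining equations, so that products
   that contain them stay in normal form. *)
Variables (H G Ph Sh : 'M[R]_n) (K : 'M[R]_(m, n)) (L : 'M[R]_(n, d)).
Hypotheses (P2u : P22 \in unitmx) (S2u : S22 \in unitmx)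
  (X2u : X22 \in unitmx).
Hypotheses (P2s : P22^T = P22) (S2s : S22^T = S22).
Hypotheses (Phs : Ph^T = Ph) (Shs : Sh^T = Sh) (Rs : Rw^T = Rw).
Hypotheses (HP : P22 *m H = - P12^T) (GS : G *m S22 = S12).
Hypotheses (PhE : Ph = P11 + P12 *m H) (ShE : Sh = S11 - G *m S12^T).
Hypotheses (Wu : Rw + B^T *m Ph *m B \in unitmx)
  (CSCu : C *m Sh *m C^T \in unitmx).
Hypotheses (KE : (Rw + B^T *m Ph *m B) *m K = B^T *m Ph *m A)
  (LE : L *m (C *m Sh *m C^T) = A *m Sh *m C^T).

Let P12E : P12 = - (H^T *m P22).
Proof. by apply: trmx_inj; rewrite linearN /= trmx_mul trmxK P2s HP opprK. Qed.

Section Gains.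
Let N := P *m F *m Sg.
Hypotheses (NA : drsubmx N = 0) (NB : dlsubmx N *m C^T = 0)
  (NC : B^T *m ursubmx N + Rw *m CK *m S22 = 0).

(* P = e1^T Ph e1 + e2^T P22 e2 and Sg = f1 Sh f1^T + f2 S22 f2^T. *)
Let e1 : 'M[R]_(n, n + n) := row_mx 1%:M 0.
Let e2 : 'M[R]_(n, n + n) := row_mx (- H) 1%:M.
Let f1 : 'M[R]_(n + n, n) := col_mx 1%:M 0.
Let f2 : 'M[R]_(n + n, n) := col_mx G 1%:M.

Let dsub_P : row_mx 0 1%:M *m P = P22 *m e2.
Proof.
rewrite /P /e2 mul_row_block !mul0mx !add0r !mul1mx mul_mx_row mulmx1.
by rewrite mulmxN HP opprK.
Qed.

Let usub_P : row_mx 1%:M 0 *m P = Ph *m e1 - H^T *m P22 *m e2.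
Proof.
rewrite /P /e1 /e2 mul_row_block !mul0mx !addr0 !mul1mx !mul_mx_row.
rewrite !mulmx1 mulmx0 opp_row_mx add_row_mx add0r mulmxN opprK.
by rewrite -P12E -[H^T *m P22]opprK -P12E mulNmx PhE addrK.
Qed.

Let rsub_S : Sg *m col_mx 0 1%:M = f2 *m S22.
Proof.
rewrite /Sg /f2 mul_block_col !mulmx0 !add0r !mulmx1 mul_col_mx mul1mx.
by rewrite GS.
Qed.

Let lsub_S : Sg *m col_mx 1%:M 0 = f1 *m Sh + f2 *m S12^T.
Proof.
rewrite /Sg /f1 /f2 mul_block_col !mulmx0 !addr0 !mulmx1 !mul_col_mx !mul1mx.
by rewrite mul0mx add_col_mx add0r ShE subrK.
Qed.

Let mulP2_eq0 p (M : 'M[R]_(n, p)) : P22 *m M = 0 -> M = 0.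
Proof. by move=> PM; rewrite -(mulKmx P2u M) PM mulmx0. Qed.

Let mulS2_eq0 p (M : 'M[R]_(p, n)) : M *m S22 = 0 -> M = 0.
Proof. by move=> PM; rewrite -(mulmxK S2u M) PM mul0mx. Qed.

Let drsubE : drsubmx N = row_mx 0 1%:M *m N *m col_mx 0 1%:M.
Proof.
rewrite -[N in RHS]submxK mul_row_block !mul0mx !add0r !mul1mx mul_row_col.
by rewrite mulmx0 add0r mulmx1.
Qed.

Let dlsubE : dlsubmx N = row_mx 0 1%:M *m N *m col_mx 1%:M 0.
Proof.
rewrite -[N in RHS]submxK mul_row_block !mul0mx !add0r !mul1mx mul_row_col.
by rewrite mulmx0 addr0 mulmx1.
Qed.

Let ursubE : ursubmx N = row_mx 1%:M 0 *m N *m col_mx 0 1%:M.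
Proof.
rewrite -[N in RHS]submxK mul_row_block !mul0mx !addr0 !mul1mx mul_row_col.
by rewrite mulmx0 add0r mulmx1.
Qed.

Let dsub_N : row_mx 0 1%:M *m N = P22 *m e2 *m F *m Sg.
Proof. by rewrite /N !mulmxA dsub_P. Qed.

Let u0 : e2 *m F *m f2 = 0.
Proof.
apply: mulP2_eq0; apply: mulS2_eq0; rewrite -[RHS]NA drsubE dsub_N.
by rewrite -(mulmxA _ Sg) rsub_S !mulmxA.
Qed.

(** In the bases that block-diagonalize P and S, the gradient with respect to
AK is P22 ((- H 1) F (G; 1)) S22, with invertible outer factors. *)
Lemma stationary_AK : AK = H *m (A *m G + B *m CK) - BK *m C *m G.
Proof.
have := u0; rewrite -mulmxA /F /e2 /f2 mul_block_col mul_row_col !mulmx1.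
by rewrite mul1mx mulNmx => /addr0_eq; rewrite opprK => ->; rewrite addrC addKr.
Qed.

(** Once the component (- H 1) F (G; 1) is zero, the gradient with respect to
BK is P22 (BK C - H A) Sh C^T. *)
Lemma stationary_BK : BK = H *m L.
Proof.
have v0 : e2 *m F *m f1 *m Sh *m C^T = 0.
  have Pu0 : P22 *m e2 *m F *m f2 = 0 by rewrite -!mulmxA (mulmxA e2) u0 mulmx0.
  apply: mulP2_eq0; rewrite -[RHS]NB dlsubE dsub_N -(mulmxA _ Sg) lsub_S.
  by rewrite mulmxDr !mulmxA Pu0 mul0mx addr0.
move: v0; rewrite -(mulmxA e2) /F /e2 /f1 mul_block_col mul_row_col !mulmx1.
rewrite !mulmx0 !addr0 mul1mx mulNmx addrC 2!mulmxBl => /subr0_eq BE.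
by rewrite -(mulmxK CSCu BK) !mulmxA BE -(mulmxK CSCu L) LE !mulmxA.
Qed.

(** Likewise the gradient with respect to CK reduces to (B^T Ph (A G + B CK) +
Rw CK) S22. *)
Lemma stationary_CK : CK = - (K *m G).
Proof.
have w0 : B^T *m Ph *m (A *m G + B *m CK) + Rw *m CK = 0.
  have w_eq : e1 *m F *m f2 = A *m G + B *m CK.
    rewrite /e1 /F /f2 mul_row_block !mul1mx !mul0mx !addr0.
    by rewrite mul_row_col mulmx1.
  apply: mulS2_eq0; rewrite -[RHS]NC ursubE mulmxDl; congr (_ + _).
  have -> : row_mx 1%:M 0 *m N = (Ph *m e1 - H^T *m P22 *m e2) *m F *m Sg.
    by rewrite /N !mulmxA usub_P.
  rewrite -(mulmxA _ Sg) rsub_S !mulmxBl (mulmxA _ f2) -(mulmxA _ e2 F).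
  rewrite -(mulmxA _ (e2 *m F)) (mulmxA (e2 *m F)) u0 mul0mx mulmx0 subr0.
  by rewrite -2!(mulmxA Ph) w_eq !mulmxA.
apply: (can_inj (mulKmx Wu)); rewrite mulmxN mulmxA KE.
apply/eqP; rewrite -addr_eq0 mulmxDl -[X in _ == X]w0 mulmxDr !mulmxA.
by apply/eqP; mx_abel.
Qed.

End Gains.

Section Riccati.
Hypothesis PE : P = cost_weight Q Rw CK + F^T *m P *m F.
Hypothesis SgE : Sg = X + F *m Sg *m F^T.
Hypothesis AKE : AK = H *m (A *m G + B *m CK) - BK *m C *m G.
Hypothesis BKE : BK = H *m L.
Hypothesis CKE : CK = - (K *m G).

Let v := BK *m C - H *m A.
Let M := A^T *m Ph *m B *m K.
Let Z := M + v^T *m P22 *m v.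

Let KTE : K^T *m (Rw + B^T *m Ph *m B) = A^T *m Ph *m B.
Proof.
apply: trmx_inj; rewrite [LHS]trmx_mul trmxK trmxD Rs !trmx_mul !trmxK Phs.
by rewrite !mulmxA KE.
Qed.

Let MK : M = K^T *m (Rw + B^T *m Ph *m B) *m K.
Proof. by rewrite KTE. Qed.

Let Ms : M^T = M.
Proof.
by rewrite MK [LHS]trmx_mul [X in _ *m X]trmx_mul trmxK trmxD Rs !trmx_mul
  trmxK Phs !mulmxA.
Qed.

Let Zs : Z^T = Z.
Proof. by rewrite trmxD Ms !trmx_mul trmxK P2s mulmxA. Qed.

(** The rows (1 0) F and (- H 1) F are (A, - B K G) and v (1, - G), so that F^T
P F splits into two terms with known blocks. *)
Let P_blocks : [/\ P11 = Q + A^T *m Ph *m A + v^T *m P22 *m v,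
  P12 = - (Z *m G) & P22 = G^T *m Z *m G].
Proof.
pose e1 : 'M[R]_(n, n + n) := row_mx 1%:M 0.
pose e2 : 'M[R]_(n, n + n) := row_mx (- H) 1%:M.
have e1F : e1 *m F = row_mx A (- (B *m K *m G)).
  by rewrite /e1 /F mul_row_block !mul1mx !mul0mx !addr0 CKE mulmxN mulmxA.
have e2F : e2 *m F = row_mx v (- (v *m G)).
  rewrite /e2 /F mul_row_block !mul1mx AKE /v; congr row_mx.
    by rewrite mulNmx addrC.
  by rewrite mulmxDr mulmxBl !mulNmx !mulmxA; mx_abel.
have P_split : P = e1^T *m Ph *m e1 + e2^T *m P22 *m e2.
  rewrite /P /e1 /e2 !tr_row_mx !trmx1 trmx0 !mul_col_mx !mul_mx_row.
  rewrite -!block_mxEv !mul1mx !mul0mx !mulmx0 !mulmx1 add_block_mx !add0r.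
  rewrite [(- H)^T]linearN /= mulNmx -P12E !mulmxN HP opprK; congr block_mx.
  by rewrite PhE addrK.
have := PE; rewrite {2}P_split mulmxDr mulmxDl.
have -> : F^T *m (e1^T *m Ph *m e1) *m F = (e1 *m F)^T *m Ph *m (e1 *m F).
  by rewrite trmx_mul !mulmxA.
have -> : F^T *m (e2^T *m P22 *m e2) *m F = (e2 *m F)^T *m P22 *m (e2 *m F).
  by rewrite trmx_mul !mulmxA.
rewrite e1F e2F !tr_row_mx !mul_col_mx !mul_mx_row -!block_mxEv /cost_weight.
rewrite !add_block_mx => /eq_block_mx[E11 E12 _ E22]; split.
- by rewrite E11 addrA.
- rewrite E12 add0r /Z !mulmxN mulmxDl /M !mulmxA.
  by mx_abel.
- rewrite E22 CKE /Z !trmxN !trmx_mul !mulmxN !mulNmx !opprK.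
  rewrite mulmxDr mulmxDl MK mulmxDr mulmxDl !mulmxDl !mulmxDr !mulmxDl !mulmxA.
  by mx_abel.
Qed.

(** P22 = G^T Z G is invertible, hence so is its factor G. *)
Let Gu : G \in unitmx.
Proof.
have [_ _ P2E] := P_blocks.
by move: P2u; rewrite P2E unitmx_mul => /andP[].
Qed.

Let GH : G *m H = 1%:M.
Proof.
have [_ P1E P2E] := P_blocks.
have : P22 *m H = P22 *m invmx G.
  by rewrite HP P1E linearN /= opprK trmx_mul Zs {1}P2E mulmxK.
by move/(can_inj (mulKmx P2u)) => ->; rewrite mulmxV.
Qed.

Lemma stationary_inverse : H *m G = 1%:M. Proof. exact: mulmx1C GH. Qed.
Let HG := stationary_inverse.

(** In the Schur complement of P the terms carrying v cancel, because P12 H = -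
Z. *)
Lemma stationary_control_riccati : control_riccati A B Q Rw Ph.
Proof.
have [P1E P2E _] := P_blocks.
have KK : K = control_gain A B Rw Ph.
  by rewrite -(mulKmx Wu K) KE /control_gain !mulmxA.
apply/control_riccatiF; rewrite -KK.
rewrite {1}PhE P2E P1E mulNmx -(mulmxA _ G) GH mulmx1 /Z /M [in RHS]mulmxBr.
rewrite !mulmxA.
by mx_abel.
Qed.

Let Y := (A *m G + B *m CK) *m S22 *m (A *m G + B *m CK)^T.
Let V := A *m Sh *m C^T *m L^T.

Let VL : V = L *m (C *m Sh *m C^T) *m L^T.
Proof. by rewrite LE. Qed.

Let VYs : (V + Y)^T = V + Y.
Proof.
rewrite trmxD VL /Y; congr (_ + _); rewrite !trmx_mul !trmxK ?S2s ?Shs //.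
  by rewrite !mulmxA.
by rewrite mulmxA.
Qed.

(** Dual to the computation for P: the columns F (1; 0) and F (G; 1) are (A; H
L C) and (1; H) (A G + B CK). *)
Let S_blocks : [/\ S11 = X11 + A *m Sh *m A^T + Y,
  S12 = X12 + (V + Y) *m H^T & S22 = X22 + H *m (V + Y) *m H^T].
Proof.
pose f1 : 'M[R]_(n + n, n) := col_mx 1%:M 0.
pose f2 : 'M[R]_(n + n, n) := col_mx G 1%:M.
pose w := A *m G + B *m CK.
have Ff1 : F *m f1 = col_mx A (H *m L *m C).
  by rewrite /f1 /F mul_block_col !mulmx1 !mulmx0 !addr0 BKE.
have Ff2 : F *m f2 = col_mx w (H *m w).
  rewrite /f2 /F mul_block_col !mulmx1 AKE; congr col_mx.
  by rewrite addrC subrK.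
have S_split : Sg = f1 *m Sh *m f1^T + f2 *m S22 *m f2^T.
  rewrite /Sg /f1 /f2 !tr_col_mx !trmx1 trmx0 !mul_col_mx !mul_mx_row.
  rewrite -!block_mxEv !mul1mx !mul0mx !mulmx0 !mulmx1 add_block_mx !add0r.
  by rewrite GS ShE -GS trmx_mul S2s mulmxA subrK.
have := SgE; rewrite {2}S_split mulmxDr mulmxDl.
have -> : F *m (f1 *m Sh *m f1^T) *m F^T = (F *m f1) *m Sh *m (F *m f1)^T.
  by rewrite trmx_mul !mulmxA.
have -> : F *m (f2 *m S22 *m f2^T) *m F^T = (F *m f2) *m S22 *m (F *m f2)^T.
  by rewrite trmx_mul !mulmxA.
rewrite Ff1 Ff2 !tr_col_mx !mul_col_mx !mul_mx_row -!block_mxEv.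
rewrite !add_block_mx => /eq_block_mx[E11 E12 _ E22]; split.
- by rewrite E11 addrA.
- by rewrite E12 /V /Y -/w mulmxDl !trmx_mul !mulmxA addrA.
- by rewrite E22 VL /Y -/w mulmxDr mulmxDl !trmx_mul !mulmxA addrA.
Qed.

(** As H S12 = S22, the common terms of the blocks of S cancel and only those
of X remain. *)
Lemma stationary_X12 : H *m X12 = X22.
Proof.
have [_ E12 E22] := S_blocks.
have : H *m S12 = S22 by rewrite -GS mulmxA HG mul1mx.
rewrite E12 E22 [H *m (X12 + _)]mulmxDr mulmxA.
by move/(congr1 (fun W => W - H *m (V + Y) *m H^T)); rewrite !addrK.
Qed.

Lemma stationary_filter_riccati :
  filter_riccati A C (X11 - X12 *m invmx X22 *m X12^T) Sh.
Proof.
have [E11 E12 E22] := S_blocks.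
have GX : X12 *m invmx X22 = G.
  have <- : G *m X22 = X12 by rewrite -stationary_X12 mulmxA GH mul1mx.
  by rewrite mulmxK.
rewrite /filter_riccati GX {1}ShE E11 E12 trmxD [(_ *m H^T)^T]trmx_mul trmxK VYs.
rewrite mulmxDr [G *m (H *m _)]mulmxA GH mul1mx.
have -> : A *m Sh *m C^T *m invmx (C *m Sh *m C^T) *m C *m Sh *m A^T = V.
  have -> : A *m Sh *m C^T *m invmx (C *m Sh *m C^T) = L by rewrite -LE mulmxK.
  have <- : V^T = V by rewrite VL !trmx_mul !trmxK Shs !mulmxA.
  by rewrite /V !trmx_mul !trmxK Shs !mulmxA.
by mx_abel.
Qed.

End Riccati.
End Structure.

Lemma filter_weight_posdef (R : realType) n d (C : 'M[R]_(d, n)) S :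
  \rank C = d -> posdef S -> posdef (C *m S *m C^T).
Proof.
move=> Cr Sp; rewrite -{1}[C]trmxK; apply: posdef_conj => // v Cv.
have /row_freeP[D CD] : row_free C by rewrite /row_free Cr.
by rewrite -[v]mul1mx -trmx1 -CD trmx_mul -mulmxA Cv mulmx0.
Qed.

(** The definiteness hypotheses supply the inverses and the matrices H, G, Ph
and Sh that the computations above take as given. *)
Lemma stationary_structure (R : realType) (n m d : nat)
    (A : 'M[R]_n) (B : 'M[R]_(n, m)) (C : 'M[R]_(d, n))
    (Q : 'M[R]_n) (Rw : 'M[R]_m)
    (CK : 'M[R]_(m, n)) (BK : 'M[R]_(n, d)) (AK : 'M[R]_n)
    (P11 P12 P22 S11 S12 S22 X11 X12 X22 : 'M[R]_n) :
  let F := closed_loop A B C CK BK AK in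
  let P := block_mx P11 P12 P12^T P22 in
  let Sg := block_mx S11 S12 S12^T S22 in
  let X := block_mx X11 X12 X12^T X22 in
  let N := P *m F *m Sg in
  \rank C = d -> posdef Rw -> possemidef P -> posdef P22 ->
  posdef Sg -> posdef X ->
  P = cost_weight Q Rw CK + F^T *m P *m F -> Sg = X + F *m Sg *m F^T ->
  drsubmx N = 0 -> dlsubmx N *m C^T = 0 ->
  B^T *m ursubmx N + Rw *m CK *m S22 = 0 ->
  exists H G Ph Sh : 'M[R]_n,
    let K := control_gain A B Rw Ph in
    let L := filter_gain A C Sh in
    [/\ [/\ P22 *m H = - P12^T, H *m G = 1%:M & H *m X12 = X22],
        posdef Sh /\ filter_riccati A C (X11 - X12 *m invmx X22 *m X12^T) Sh,
        possemidef Ph /\ control_riccati A B Q Rw Ph &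
        [/\ CK = - (K *m G), BK = H *m L & AK = H *m (A - B *m K - L *m C) *m G]].
Proof.
move=> F P Sg X N Cr Rp Pp P2p Sp Xp PE SgE NA NB NC.
have S2p := posdef_drsub Sp; have X2p := posdef_drsub Xp.
have [P2u S2u X2u] := And3 (posdef_unit P2p) (posdef_unit S2p) (posdef_unit X2p).
pose H := - (invmx P22 *m P12^T); pose G := S12 *m invmx S22.
pose Ph := P11 + P12 *m H; pose Sh := S11 - G *m S12^T.
have HP : P22 *m H = - P12^T by rewrite /H mulmxN mulKVmx.
have GS : G *m S22 = S12 by rewrite /G mulmxKV.
have Php : possemidef Ph.
  by rewrite /Ph /H mulmxN mulmxA; apply: schur_psd.
have Shp : posdef Sh by apply: schur_posdef Sp.
have Wu := posdef_unit (control_weight_posdef B Rp Php).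
have CSCu := posdef_unit (filter_weight_posdef Cr Shp).
pose K := control_gain A B Rw Ph; pose L := filter_gain A C Sh.
have KE := control_gainE A Wu.
have LE : L *m (C *m Sh *m C^T) = A *m Sh *m C^T by rewrite /L mulmxKV.
have [P2s S2s] := conj P2p.1 S2p.1; have [Phs Shs] := conj Php.1 Shp.1.
have Rs := Rp.1; have PhE : Ph = P11 + P12 *m H by [].
have ShE : Sh = S11 - G *m S12^T by [].
have AKE := stationary_AK P2u S2u HP GS NA.
have BKE := stationary_BK P2u S2u HP GS ShE CSCu LE NA NB.
have CKE := stationary_CK P2u S2u P2s HP GS PhE Wu KE NA NC.
exists H, G, Ph, Sh; split.
- split=> //.
    exact: stationary_inverse P2u P2s Phs Rs HP PhE KE PE AKE CKE.
  exact: stationary_X12 P2u P2s S2s Phs Rs HP GS PhE ShE KE LE PE SgE AKE BKE CKE.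
- split=> //.
  exact: stationary_filter_riccati P2u X2u P2s S2s Phs Shs Rs HP GS PhE ShE CSCu
    KE LE PE SgE AKE BKE CKE.
- split=> //.
  exact: stationary_control_riccati P2u P2s Phs Rs HP PhE Wu KE PE AKE CKE.
- split=> //; rewrite {1}AKE {1}CKE BKE !mulmxDr !mulmxDl !mulmxN !mulNmx !mulmxA.
  by mx_abel.
Qed.

(** * Optimal transformation and uniqueness *)

Section Main.
Context {R : realType}.

(** If Q had no semidefinite square root, then sqrtmx Q would be zero, and
observability would force n = 0, where the identity is trivial. *)
Lemma sqrtmx_gram n (Q A : 'M[R]_n) :
  observable (sqrtmx Q) A -> Q = (sqrtmx Q)^T *m sqrtmx Q.
Proof.
rewrite /sqrtmx; case: xgetP => [S -> [[Ss _] SQ] _|noS obs].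
  by rewrite Ss SQ.
have n0 : n = 0%N.
  rewrite -obs /observable; apply/eqP; rewrite mxrank_eq0; apply/eqP.
  by rewrite -(mxcol0 _); apply: eq_mxcol => i; rewrite mul0mx.
by move: Q {noS obs A}; rewrite n0 => Q; apply/matrixP => -[].
Qed.

Lemma sym_block n (M : 'M[R]_(n + n)) : M^T = M ->
  M = block_mx (ulsubmx M) (ursubmx M) (ursubmx M)^T (drsubmx M).
Proof. by move=> Ms; rewrite trmx_ursub Ms submxK. Qed.

(** The filter equation is the control equation of the transposed system with
zero control weight. *)
Lemma filter_riccati_dual n d (A : 'M[R]_n) (C : 'M[R]_(d, n)) X S :
  filter_riccati A C X S <-> control_riccati A^T C^T X 0 S.
Proof. by rewrite /filter_riccati /control_riccati !trmxK add0r. Qed.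

(** The weight X is definite, so that each solution is by itself a Lyapunov
function of its closed loop; definiteness also makes C S C^T invertible when C
has full row rank, which stands in for a control weight. *)
Lemma filter_riccati_unique n d (A : 'M[R]_n) (C : 'M[R]_(d, n)) X S S' :
  \rank C = d -> posdef X -> posdef S -> posdef S' ->
  filter_riccati A C X S -> filter_riccati A C X S' -> S = S'.
Proof.
move=> Cr Xp Sp Sp' /filter_riccati_dual SE /filter_riccati_dual SE'.
have Wu T : posdef T -> (0 + C^T^T *m T *m C^T) \in unitmx.
  by move=> Tp; rewrite add0r trmxK posdef_unit //; apply: filter_weight_posdef.
have Fs T : posdef T -> control_riccati A^T C^T X 0 T ->
    stable (A^T - C^T *m control_gain A^T C^T 0 T).
  move=> Tp TE; apply: (lyapunov_stable Xp (posdef_psd Tp)).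
  have := control_riccati_lyapunov Tp.1 (trmx0 _ _ _) (Wu _ Tp) TE.
  by rewrite mulmx0 mul0mx addr0.
apply: (riccati_unique Sp.1 (trmx0 _ _ _) Xp.1 (Wu _ Sp) (Wu _ Sp')) => //.
- exact: Fs.
- exact: Fs.
- exact: SE.
- exact: SE'.
Qed.

Lemma control_riccati_unique n m p (A Q : 'M[R]_n) (B : 'M[R]_(n, m))
    (Rw : 'M[R]_m) (Y : 'M[R]_(p, n)) S S' :
  posdef Rw -> Q = Y^T *m Y -> observable Y A ->
  possemidef S -> possemidef S' ->
  control_riccati A B Q Rw S -> control_riccati A B Q Rw S' -> S = S'.
Proof.
move=> Rp QE obs Sp Sp' SE SE'; have [V Vu RE] := cholesky Rp.
have Wu T : possemidef T -> (Rw + B^T *m T *m B) \in unitmx.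
  by move=> Tp; apply/posdef_unit/control_weight_posdef.
have Qs : Q^T = Q by rewrite QE trmx_mul trmxK.
apply: (riccati_unique Sp.1 Rp.1 Qs (Wu _ Sp) (Wu _ Sp')) => //.
- exact: riccati_stabilizing QE RE Vu obs Sp (Wu _ Sp) SE.
- exact: riccati_stabilizing QE RE Vu obs Sp' (Wu _ Sp') SE'.
- exact: SE.
- exact: SE'.
Qed.

(** A controller state v of value zero, with the plant at rest, yields zero
input at all times; the plant then stays at rest, the controller evolves
freely, and observability gives v = 0. *)
Lemma observable_value_posdef n m d p (A Q : 'M[R]_n) (B : 'M[R]_(n, m))
    (C : 'M[R]_(d, n)) (Rw : 'M[R]_m) (Y : 'M[R]_(p, n)) CK BK AK
    (P : 'M[R]_(n + n)) :
  let F := closed_loop A B C CK BK AK in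
  posdef Rw -> Q = Y^T *m Y -> observable CK AK -> possemidef P ->
  P = cost_weight Q Rw CK + F^T *m P *m F -> posdef (drsubmx P).
Proof.
move=> F Rp QE obs Pp PE; have [V Vu RE] := cholesky Rp.
pose W := block_mx Y 0 0 (V *m CK).
have WE : cost_weight Q Rw CK = W^T *m W.
  rewrite /W tr_block_mx mulmx_block !trmx0 !mul0mx !mulmx0 !addr0 add0r.
  by rewrite /cost_weight QE RE trmx_mul !mulmxA.
have P2E v : qform (drsubmx P) v = qform P (col_mx 0 v).
  rewrite -{2}[P]submxK /qform tr_col_mx trmx0 mul_row_block mul_row_col.
  by rewrite !mul0mx !add0r mulmx0 add0r.
apply: psd_posdef.
  by split=> [|v]; rewrite ?trmx_drsub ?Pp.1 // P2E; apply: Pp.2.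
move=> v; rewrite P2E WE in PE * => Pv.
have W0 := gram_unobservable Pp PE Pv.
have Ft t : F ^+ t *m col_mx 0 v = col_mx 0 (AK ^+ t *m v).
  elim: t => [|t IH]; first by rewrite !expr0 !mul1mx.
  have := W0 t; rewrite -mulmxA IH /W mul_block_col !mul0mx !mulmx0 !add0r.
  rewrite -[0 in RHS]col_mx0 => /eq_col_mx[_ VC].
  have CA : CK *m (AK ^+ t *m v) = 0.
    by rewrite -(mulKmx Vu (CK *m _)) (mulmxA V) VC mulmx0.
  rewrite !exprS -!mulmxE -!mulmxA IH /F /closed_loop mul_block_col.
  by rewrite !mulmx0 !add0r -mulmxA CA mulmx0.
apply: (observable_eq0 obs) => t.
have := W0 t; rewrite -mulmxA Ft /W mul_block_col !mul0mx !mulmx0 !add0r.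
rewrite -[0 in RHS]col_mx0 => /eq_col_mx[_ VC].
by rewrite -(mulKmx Vu (CK *m _ *m _)) -!mulmxA (mulmxA V) VC mulmx0.
Qed.

(** The relations between P12, X12 and H turn the terms linear in V into - 2 tr
(P22 X22 V^T), so the square can be completed around V = 1. *)
Lemma cost_gap n (P11 P12 P22 X11 X12 X22 H G V : 'M[R]_n) :
  P22^T = P22 -> X22^T = X22 -> P22 *m H = - P12^T -> H *m G = 1%:M ->
  G *m X22 = X12 ->
  let P := block_mx P11 P12 P12^T P22 in
  let X := block_mx X11 X12 X12^T X22 in
  let D := block_mx 1%:M 0 0 V in
  \tr (P *m (D *m X *m D^T)) =
  \tr (P *m X) + \tr (P22 *m ((V - 1%:M) *m X22 *m (V - 1%:M)^T)).
Proof.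
move=> P2s X2s HP HG GX P X D.
have PX : P12^T *m X12 = - (P22 *m X22).
  by rewrite -GX -[P12^T]opprK -HP mulNmx mulmxA -(mulmxA P22) HG mulmx1.
have XP : X12^T *m P12 = - (X22 *m P22).
  by apply: trmx_inj; rewrite trmx_mul trmxK PX !trmxN trmx_mul P2s X2s.
have t1 : \tr (P22 *m V *m X22) = \tr (P22 *m X22 *m V^T).
  rewrite -mxtrace_tr !trmx_mul P2s X2s mulmxA mxtrace_mulC.
  by rewrite mulmxA.
have t2 : \tr (P12 *m V *m X12^T) = - \tr (P22 *m V *m X22).
  rewrite mxtrace_mulC mulmxA XP mulNmx raddfN /= -mxtrace_mulC.
  by rewrite mulmxA mxtrace_mulC mulmxA.
have t3 : \tr (P12 *m X12^T) = - \tr (P22 *m X22).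
  by rewrite mxtrace_mulC XP raddfN /= mxtrace_mulC.
rewrite /P /X /D tr_block_mx !mulmx_block !trmx0 !trmx1.
rewrite !(mul0mx, mulmx0, mul1mx, mulmx1, addr0, add0r) !mxtrace_block.
rewrite trmxB trmx1 !(mulmxBl, mulmxBr) !mul1mx !mulmx1 !mulmxA.
rewrite PX !mulNmx !(raddfD, raddfN) /= t2 t3 t1.
by ring.
Qed.

Section Stationary.
Variables (n m d : nat) (A : 'M[R]_n) (B : 'M[R]_(n, m)) (C : 'M[R]_(d, n)).
Variables (Q : 'M[R]_n) (Rw : 'M[R]_m).
Context {disp : measure_display} {Omega : measurableType disp}.
Variables (Pr : probability Omega R) (x : Omega -> 'cV[R]_(n + n)).
Hypotheses (hQ : possemidef Q) (hR : posdef Rw).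
Hypotheses (hmom : finite_second_moments Pr x) (hC : \rank C = d).
Hypotheses (hX : posdef (second_moment Pr x)) (hQA : observable (sqrtmx Q) A).

Let X := second_moment Pr x.
Let X11 := ulsubmx X.
Let X12 := ursubmx X.
Let X22 := drsubmx X.

(** The observer-based regulator: the controller state estimates x with output
injection gain L and is fed back with gain - K. *)
Definition riccati_controller (S P : 'M[R]_n) : 'M[R]_(m + n, d + n) :=
  controller (- control_gain A B Rw P) (filter_gain A C S)
    (A - B *m control_gain A B Rw P - filter_gain A C S *m C).

Let XE : X = block_mx X11 X12 X12^T X22.
Proof. exact/sym_block/hX.1. Qed.

Let X22p : posdef X22.
Proof. by have := hX; rewrite -/X XE; apply: posdef_drsub. Qed.

(** The transformed closed loop is conjugate to F by the block matrix of 1 and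
U, so its value matrix is the congruent one. *)
Lemma similarity_cost CK BK AK (U V : 'M[R]_n) P :
  let F := closed_loop A B C CK BK AK in
  let D := block_mx 1%:M 0 0 V in
  stable F -> P = cost_weight Q Rw CK + F^T *m P *m F ->
  U *m V = 1%:M ->
  dlqr_cost A B C Q Rw Pr x (controller (CK *m V) (U *m BK) (U *m AK *m V)) =
  (\tr (P *m (D *m X *m D^T)))%:E.
Proof.
move=> F D Fs PE UV; have VU := mulmx1C UV.
pose E : 'M[R]_(n + n) := block_mx 1%:M 0 0 U.
have DE : D *m E = 1%:M.
  rewrite /D /E mulmx_block !(mulmx0, mul0mx, mulmx1, mul1mx, addr0, add0r) VU.
  by rewrite -scalar_mx_block.
have ED := mulmx1C DE.
have FE : closed_loop A B C (CK *m V) (U *m BK) (U *m AK *m V) = E *m F *m D.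
  rewrite /E /F /D /closed_loop !mulmx_block.
  by rewrite !(mulmx0, mul0mx, mulmx1, mul1mx, addr0, add0r) !mulmxA.
have WE : cost_weight Q Rw (CK *m V) = D^T *m cost_weight Q Rw CK *m D.
  rewrite /D /cost_weight tr_block_mx !mulmx_block !trmx0 trmx1.
  rewrite !(mulmx0, mul0mx, mulmx1, mul1mx, addr0, add0r).
  by rewrite trmx_mul !mulmxA.
have Fs' : stable (E *m F *m D).
  apply: (@vanishes_ext _ _ _ (fun t => E *m F ^+ t *m D)); last first.
    exact/vanishesMr/vanishesMl.
  elim=> [|t IH]; first by rewrite !expr0 mulmx1 ED.
  by rewrite [in RHS]exprS -IH exprS -!mulmxE !mulmxA -(mulmxA _ D E) DE mulmx1.
rewrite (dlqr_costE hmom hQ hR (S := D^T *m P *m D)) ?FE ?WE //.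
  by rewrite -/X -!mulmxA mxtrace_mulC !mulmxA.
rewrite {1}PE mulmxDr mulmxDl; congr (_ + _).
rewrite !trmx_mul !mulmxA -(mulmxA _ D E) DE mulmx1.
have DEt : E^T *m D^T = 1%:M by rewrite -trmx_mul DE trmx1.
by rewrite -(mulmxA _ E^T D^T) DEt mulmx1.
Qed.

(** Here T ranges over the transformations of the Riccati controller, and V = H
T^-1 relates the T-transform to the stationary controller itself, whose value
matrix P is known. *)
Lemma stationary_form K :
  (observable_controllers `&` stationary_points A B C Q Rw Pr x
     `&` stabilizing_controllers A B C) K ->
  exists S P : 'M[R]_n,
    [/\ posdef S /\ filter_riccati A C (X11 - X12 *m invmx X22 *m X12^T) S,
        posdef P /\ control_riccati A B Q Rw P,
        X12 \in unitmx,
        K = similarity (X22 *m invmx X12) (riccati_controller S P) &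
        [set T | optimal_transformation A B C Q Rw Pr x
                   (riccati_controller S P) T] = [set X22 *m invmx X12]].
Proof.
move=> [[[KE obs] stat] [_ rho]].
have {}KE : K = controller (ctrlC K) (ctrlB K) (ctrlA K) by exact: KE.
move: KE obs stat rho => /=.
move: (ctrlC K) (ctrlB K) (ctrlA K) => CK BK AK ->.
rewrite closed_loopE => obs stat rho.
have Fs := spectral_radius_stable rho; set F := closed_loop _ _ _ _ _ _ in Fs rho.
have [P PE] := stein_exists (cost_weight Q Rw CK) Fs.
have Pp := stein_psd Fs (cost_weight_psd hQ hR CK) PE.
have [Sg SgE] := stein_dual_exists X Fs.
have Sp := stein_dual_posdef Fs hX SgE.
have P2p := observable_value_posdef hR (sqrtmx_gram hQA) obs Pp PE.
have [NA NB NC] := stationary_equations hQ hR hmom hX Fs PE SgE stat.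
have PB := sym_block Pp.1; have SB := sym_block Sp.1.
set P11 := ulsubmx P in PB; set P12 := ursubmx P in PB.
set P22 := drsubmx P in PB P2p.
set S11 := ulsubmx Sg in SB; set S12 := ursubmx Sg in SB.
set S22 := drsubmx Sg in SB NC.
have Pp' := Pp; have PE' := PE.
rewrite PB SB in PE SgE Pp Sp NA NB NC; rewrite XE in SgE.
have Xp := hX; rewrite -/X XE in Xp.
have [H [G [Ph [Sh [[HP HG HX] [Shp SE] [Php RE] [CKE BKE AKE]]]]]] :=
  stationary_structure hC hR Pp P2p Sp Xp PE SgE NA NB NC.
set Kg := control_gain A B Rw Ph in CKE AKE.
set L := filter_gain A C Sh in BKE AKE.
have GH := mulmx1C HG.
have GX : G *m X22 = X12 by rewrite -HX mulmxA GH mul1mx.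
have X12u : X12 \in unitmx.
  by have := posdef_unit X22p; rewrite -HX unitmx_mul => /andP[].
have TE : X22 *m invmx X12 = H by rewrite -HX mulmxK.
have HV : invmx H = G.
  by rewrite -[invmx H]mulmx1 -HG mulKmx //; case: (mulmx1_unit HG).
have [V Vu VE] := cholesky hR.
have Wu := posdef_unit (control_weight_posdef B hR Php).
have QE := sqrtmx_gram hQA.
exists Sh, Ph; split=> //.
- by split=> //; apply: riccati_posdef QE VE Vu hQA Php Wu RE.
- rewrite /similarity /riccati_controller ctrlCE ctrlBE ctrlAE -/Kg -/L TE HV.
  by rewrite -AKE -BKE mulNmx -CKE.
have costE T : T \in unitmx ->
    dlqr_cost A B C Q Rw Pr x (similarity T (riccati_controller Sh Ph)) =
    (\tr (P *m X) + \tr (P22 *m ((H *m invmx T - 1%:M) *m X22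
       *m (H *m invmx T - 1%:M)^T)))%:E.
  move=> Tu; have UV : (T *m G) *m (H *m invmx T) = 1%:M.
    by rewrite mulmxA -(mulmxA T) GH mulmx1 mulmxV.
  rewrite /similarity /riccati_controller ctrlCE ctrlBE ctrlAE -/Kg -/L.
  have <- : CK *m (H *m invmx T) = - Kg *m invmx T.
    by rewrite CKE mulNmx -(mulmxA Kg) (mulmxA G) GH mul1mx mulNmx.
  have <- : (T *m G) *m BK = T *m L.
    by rewrite BKE -(mulmxA T) (mulmxA G) GH mul1mx.
  have <- : (T *m G) *m AK *m (H *m invmx T) =
      T *m (A - B *m Kg - L *m C) *m invmx T.
    rewrite AKE -!(mulmxA H) -(mulmxA T) (mulmxA G) GH mul1mx !mulmxA.
    by rewrite -(mulmxA _ G) GH mulmx1.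
  rewrite (similarity_cost Fs PE' UV) {1 2}PB {1 2}XE; congr EFin.
  exact: (cost_gap P11 X11 (H *m invmx T) P2p.1 X22p.1 HP HG GX).
have Hu : H \in unitmx by case: (mulmx1_unit HG).
have gapH : \tr (P22 *m ((H *m invmx H - 1%:M) *m X22
    *m (H *m invmx H - 1%:M)^T)) = 0.
  by rewrite mulmxV // subrr !mul0mx mulmx0 mxtrace0.
rewrite TE; apply/seteqP; split=> [T /= [Tu Tmin]|T /= ->].
  have := Tmin _ Hu; rewrite (costE _ Hu) (costE _ Tu) gapH addr0.
  rewrite lee_fin gerDl leNgt.
  have [HT _|HT] := eqVneq (H *m invmx T - 1%:M) 0; last first.
    by rewrite (trace_conj_gt0 P2p X22p HT).
  by rewrite -[RHS](mulmxKV Tu) (subr0_eq HT) mul1mx.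
split=> [|U Uu]; first exact: Hu.
rewrite (costE _ Hu) (costE _ Uu) gapH addr0 lee_fin lerDl.
have [->|HU] := eqVneq (H *m invmx U - 1%:M) 0.
  by rewrite !mul0mx mulmx0 mxtrace0.
by rewrite ltW // trace_conj_gt0.
Qed.
End Stationary.
End Main.

Theorem theorem1 (R : realType) (n m d : nat)
    (A : 'M[R]_n) (B : 'M[R]_(n, m)) (C : 'M[R]_(d, n))
    (Q : 'M[R]_n) (Rw : 'M[R]_m)
    (disp : measure_display) (Omega : measurableType disp)
    (P : probability Omega R) (xbar0 : Omega -> 'cV[R]_(n + n))
    (hQ : possemidef Q) (hR : posdef Rw)
    (hmom : finite_second_moments P xbar0)
    (hC : \rank C = d)
    (hX : posdef (second_moment P xbar0))
    (hAB : controllable A B)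
    (hCA : observable C A)
    (hQA : observable (sqrtmx Q) A)
    (Kstar : 'M[R]_(m + n, d + n))
    (hKstar : (observable_controllers
               `&` stationary_points A B C Q Rw P xbar0
               `&` stabilizing_controllers A B C) Kstar) :
  let X11 := ulsubmx (second_moment P xbar0) in
  let X12 := ursubmx (second_moment P xbar0) in
  let X22 := drsubmx (second_moment P xbar0) in
  let DeltaX := X11 - X12 *m invmx X22 *m X12^T in
  (forall K' : 'M[R]_(m + n, d + n),
     (observable_controllers
      `&` stationary_points A B C Q Rw P xbar0
      `&` stabilizing_controllers A B C) K' -> K' = Kstar) /\
  X12 \in unitmx /\
  exists Sigma Phat : 'M[R]_n,
    [set S | posdef S /\ filter_riccati A C DeltaX S] = [set Sigma] /\
    [set S | posdef S /\ control_riccati A B Q Rw S] = [set Phat] /\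
    let Lstar := filter_gain A C Sigma in
    let Kgain := control_gain A B Rw Phat in
    let Kdd := controller (- Kgain) Lstar (A - B *m Kgain - Lstar *m C) in
    let Tstar := X22 *m invmx X12 in
    [set T | optimal_transformation A B C Q Rw P xbar0 Kdd T] = [set Tstar] /\
    Kstar = similarity Tstar Kdd.
Proof.
move=> X11 X12 X22 DeltaX.
have Dp : posdef DeltaX.
  by apply: schur_posdef; rewrite -(sym_block hX.1).
have QE := sqrtmx_gram hQA.
have Suniq S S' : posdef S /\ filter_riccati A C DeltaX S ->
    posdef S' /\ filter_riccati A C DeltaX S' -> S = S'.
  by move=> [Sp SE] [Sp' SE']; apply: filter_riccati_unique hC Dp Sp Sp' SE SE'.
have Puniq S S' : posdef S /\ control_riccati A B Q Rw S ->
    posdef S' /\ control_riccati A B Q Rw S' -> S = S'.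
  move=> [Sp SE] [Sp' SE'].
  exact: control_riccati_unique hR QE hQA (posdef_psd Sp) (posdef_psd Sp') SE SE'.
have form := stationary_form (B := B) hQ hR hmom hC hX hQA.
have [S [Ph [SP PP X12u KE optE]]] := form _ hKstar.
split; first move=> K' /form[S' [P' [SP' PP' _ -> _]]].
  by rewrite KE (Suniq _ _ SP' SP) (Puniq _ _ PP' PP).
split=> //; exists S, Ph; split; last split; last by split.
  by apply/seteqP; split=> [T /Suniq/(_ SP)|T ->].
by apply/seteqP; split=> [T /Puniq/(_ PP)|T ->].
Qed.
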